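(* Let $\varpi$ be a probability distribution with support $\mathsf{X}\times\mathsf{Y}\subseteq\mathbb{R}^k\times\mathbb{R}^l$, let $p\in(0,1)$, and let $\Phi_X$, $\Phi_{DGS}$, $\Phi_{RGS}$ be the associated marginal chain, deterministic scan Gibbs sampler and random scan Gibbs sampler (with selection probability $p$), with Markov kernels $P_X$, $P_{DGS}$, $P_{RGS}$. Suppose $P_X$ and $P_{RGS}$ are Feller. If there exists a function $V:\mathsf{X}\to\mathbb{R}^+$ such that both $V$ and the corresponding function $$W(x,y)=V(x)+c\,G(y),\qquad G(y)=\int_{\mathsf{X}}V(x)\,\pi_{X|Y}(x|y)\,\mu_X(dx),$$ where $c>0$, are unbounded off compact sets, and there exist constants $0<\lambda<1$ and $L<\infty$ such that for all $x\in\mathsf{X}$ $$P_XV(x)\le\lambda V(x)+L,$$ then $\Phi_X$, $\Phi_{DGS}$ and $\Phi_{RGS}$ are geometrically ergodic.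
   Context: Setting. $\varpi$ is a probability distribution having support $\mathsf{X}\times\mathsf{Y}\subseteq\mathbb{R}^k\times\mathbb{R}^l$, $k,l\ge1$, with density $\pi(x,y)$ with respect to a measure $\mu=\mu_X\times\mu_Y$. The marginal densities are $\pi_X(x)=\int_{\mathsf{Y}}\pi(x,y)\mu_Y(dy)$ and $\pi_Y(y)=\int_{\mathsf{X}}\pi(x,y)\mu_X(dx)$, and the conditional densities are $\pi_{X|Y}(x|y)=\pi(x,y)/\pi_Y(y)$ and $\pi_{Y|X}(y|x)=\pi(x,y)/\pi_X(x)$. $\varpi_X$ denotes the $X$-marginal of $\varpi$. Kernels. $P_{DGS}((x,y),A)=\int_A\pi_{X|Y}(x'|y)\pi_{Y|X}(y'|x')\,\mu(d(x',y'))$ on $\mathsf{X}\times\mathsf{Y}$. $P_X(x,A)=\int_A k_X(x'|x)\mu_X(dx')$ on $\mathsf{X}$, where $k_X(x'|x)=\int_{\mathsf{Y}}\pi_{X|Y}(x'|y)\pi_{Y|X}(y|x)\mu_Y(dy)$. For fixed $p\in(0,1)$, $P_{RGS}$ on $\mathsf{X}\times\mathsf{Y}$ is: from $(x,y)$, with probability $p$ move to $(x',y)$ with $x'$ drawn from $\pi_{X|Y}(\cdot|y)$, and with probability $1-p$ move to $(x,y')$ with $y'$ drawn from $\pi_{Y|X}(\cdot|x)$; i.e. $P_{RGS}((x,y),A)=p\int 1_A(x',y)\pi_{X|Y}(x'|y)\mu_X(dx')+(1-p)\int 1_A(x,y')\pi_{Y|X}(y'|x)\mu_Y(dy')$. The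 invariant distributions are $\varpi$ for $P_{DGS}$ and $P_{RGS}$, and $\varpi_X$ for $P_X$. $\Phi_X,\Phi_{DGS},\Phi_{RGS}$ are the corresponding Markov chains. Definitions. For a Markov kernel $P$ on a topological space $\mathsf{Z}$ with its Borel $\sigma$-algebra, $Pf(z)=\int_{\mathsf{Z}} f(z')P(z,dz')$ for measurable $f$. $P$ is Feller if $P(\cdot,O)$ is a lower semicontinuous function for every open set $O$. A function $U$ on $\mathsf{Z}$ is unbounded off compact sets if the sublevel set $\{z\in\mathsf{Z}:U(z)\le d\}$ is compact for every $d>0$. A chain with kernel $P$, $n$-step kernel $P^n$ and invariant probability measure $w$ is geometrically ergodic if there exist a real-valued function $M$ on $\mathsf{Z}$ and $0<t<1$ such that $\|P^n(z,\cdot)-w(\cdot)\|_{TV}\le M(z)t^n$ for all $z\in\mathsf{Z}$ and all $n$, where $\|\cdot\|_{TV}$ is the total variation norm.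
   Formalization: ''Support X×Y'' is taken as π>0 almost everywhere on X×Y with X and Y locally compact (automatic for a closed support); with topological support alone the claim fails, as Φ_X can have an absorbing point. G(y) is assumed finite for all y. *)

(* Defs.v *)
From HB Require Import structures.
From mathcomp Require Import all_boot all_order all_algebra.
From mathcomp Require Import all_classical all_reals all_analysis.
From mathcomp Require Import measurable_realfun lebesgue_Rintegral.

Set Implicit Arguments.
Unset Strict Implicit.
Unset Printing Implicit Defensive.
Import Order.TTheory GRing.Theory Num.Theory.
Import numFieldNormedType.Exports.
Local Open Scope classical_set_scope.
Local Open Scope ring_scope.

(* A nonempty subset [A] of a topological space as a space of its own, with
   the topology induced by [U] and its Borel sigma-algebra.  Nonemptiness is
   only there because MathComp-Analysis measurable types are pointed.  The
   product of two such types carries the product topology and the product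
   sigma-algebra; for subsets of Euclidean spaces the latter is the Borel
   sigma-algebra of the former, by second countability. *)
Definition state_space {U : topologicalType} (A : set U) (A0 : A !=set0) : Type :=
  set_type A.

Section state_space_instances.
Context {U : topologicalType} (A : set U) (A0 : A !=set0).

Definition state_space_point : state_space A0 :=
  exist _ (projT1 (cid A0)) (mem_set (projT2 (cid A0))).

HB.instance Definition _ :=
  Topological.copy (state_space A0) (initial_topology (@set_val U A)).
HB.instance Definition _ := isPointed.Build (state_space A0) state_space_point.
HB.instance Definition _ :=
  @isMeasurable.Build (sigma_display (@open (state_space A0))) (state_space A0)
  <<s @open (state_space A0) >> (@sigma_algebra0 _ setT _)
  (@sigma_algebraC _ _) (@sigma_algebra_bigcup _ setT _).
End state_space_instances.

Section markov_kernels.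
Local Open Scope ereal_scope.

Definition feller {Z : topologicalType} {R : realType}
    (P : Z -> set Z -> \bar R) : Prop :=
  forall O : set Z, open O -> lower_semicontinuous (fun z => P z O).

Definition unbounded_off_compact {Z : topologicalType} {R : realType}
    (U : Z -> R) : Prop :=
  forall d : R, (0 < d)%R -> compact [set z | (U z <= d)%R].

Context {d : measure_display} {Z : measurableType d} {R : realType}.

Definition kernel_op (P : R.-pker Z ~> Z) (f : Z -> \bar R) (z : Z) : \bar R :=
  \int[P z]_z' f z'.

Fixpoint kernel_iter (P : R.-pker Z ~> Z) (n : nat) (z : Z) (A : set Z) : \bar R :=
  if n is n'.+1 then kernel_op P (fun z' => kernel_iter P n' z' A) z
  else \d_z A.

(* For a finite signed measure [nu] with Hahn decomposition [(D, ~` D)], the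
   supremum is [nu D] and the infimum is [nu (~` D)]; the difference is thus
   the total mass of the variation of [nu], as well as the supremum of the
   integrals against [nu] of the measurable functions bounded by 1. *)
Definition tv_norm (nu : set Z -> \bar R) : \bar R :=
  ereal_sup [set nu A | A in measurable] - ereal_inf [set nu A | A in measurable].

Definition geometrically_ergodic (P : R.-pker Z ~> Z) (w : set Z -> \bar R) : Prop :=
  exists (M : Z -> R) (t : R), (0 < t < 1)%R /\
    forall z n, tv_norm (fun A => kernel_iter P n z A - w A) <= (M z * t ^+ n)%:E.

End markov_kernels.

Section integral_ge0_measure.
Local Open Scope ereal_scope.
Context {d : measure_display} {T : measurableType d} {R : realType}.
Variables (mu : {measure set T -> \bar R}) (f : T -> \bar R).
Hypotheses (mf : measurable_fun setT f) (f0 : forall x, 0 <= f x).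

Lemma integral_ge0_sigma_additive :
  semi_sigma_additive (fun A => \int[mu]_(x in A) f x).
Proof.
move=> F mF tF mUF; rewrite ge0_integral_bigcup//; last exact: measurable_funTS.
by apply: is_cvg_ereal_nneg_natsum => n _; exact: integral_ge0.
Qed.
End integral_ge0_measure.

Lemma measurable_fun_integral_in {d d' : measure_display} {T : measurableType d}
    {T' : measurableType d'} {R : realType}
    (mu : {sigma_finite_measure set T' -> \bar R}) (f : T * T' -> \bar R)
    (A : set T') : measurable_fun setT f -> (forall w, 0 <= f w)%E ->
  measurable A -> measurable_fun setT (fun t => \int[mu]_(t' in A) f (t, t'))%E.
Proof.
move=> mf f0 mA; pose g := f \_ (setT `*` A).
have -> : (fun t => \int[mu]_(t' in A) f (t, t'))%E = fubini_F mu g.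
  apply/funext => t; rewrite /fubini_F [LHS]integral_mkcond.
  apply: eq_integral => t' _.
  by rewrite /g !patchE in_setX in_setT.
apply: measurable_fun_fubini_tonelli_F.
- apply/(measurable_restrictT _ _).1; last exact: measurable_funTS.
  exact: measurableX.
- by move=> w; apply: erestrict_ge0.
Qed.

Section gibbs.
Local Open Scope ereal_scope.
Context {d1 d2 : measure_display} {X : measurableType d1} {Y : measurableType d2}
  {R : realType}.
Variables (muX : {sigma_finite_measure set X -> \bar R})
  (muY : {sigma_finite_measure set Y -> \bar R})
  (varpi : probability (X * Y)%type R).

(* A version [density] of the density of [varpi] for which all the conditional
   densities are defined, that is, both marginal densities are finite and
   positive everywhere. *)
Record joint_density := JointDensity {
  density :> X * Y -> R ;
  density_ge0 : forall z, (0 <= density z)%R ;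
  measurable_density : measurable_fun setT density ;
  densityE : forall A, measurable A ->
    varpi A = \int[muX \x muY]_(z in A) (density z)%:E ;
  density_integrableX : forall x,
    muY.-integrable setT (fun y => (density (x, y))%:E) ;
  density_integrableY : forall y,
    muX.-integrable setT (fun x => (density (x, y))%:E) ;
  density_marginX_gt0 : forall x, (0 < \int[muY]_y density (x, y))%R ;
  density_marginY_gt0 : forall y, (0 < \int[muX]_x density (x, y))%R
}.

Variable pi : joint_density.

Definition marginX (x : X) : R := (\int[muY]_y pi (x, y))%R.
Definition marginY (y : Y) : R := (\int[muX]_x pi (x, y))%R.
Definition condX (x : X) (y : Y) : R := (pi (x, y) / marginY y)%R.
Definition condY (y : Y) (x : X) : R := (pi (x, y) / marginX x)%R.

Definition marginal_density (x' x : X) : \bar R :=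
  \int[muY]_y (condX x' y * condY y x)%:E.

Definition marginal_chain (x : X) (A : set X) : \bar R :=
  \int[muX]_(x' in A) marginal_density x' x.

Definition deterministic_scan (z : X * Y) (A : set (X * Y)) : \bar R :=
  \int[muX \x muY]_(w in A) (condX w.1 z.2 * condY w.2 w.1)%:E.

Definition random_scan (p : R) (z : X * Y) (A : set (X * Y)) : \bar R :=
  p%:E * \int[muX]_x' (\1_A (x', z.2) * condX x' z.2)%:E +
  (1 - p)%:E * \int[muY]_y' (\1_A (z.1, y') * condY y' z.1)%:E.

Definition drift_G (V : X -> R) (y : Y) : \bar R :=
  \int[muX]_x (V x * condX x y)%:E.

Definition drift_W (V : X -> R) (c : R) (z : X * Y) : R :=
  (V z.1 + c * fine (drift_G V z.2))%R.

Let marginXE x : (marginX x)%:E = \int[muY]_y (pi (x, y))%:E.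
Proof. by rewrite fineK//; apply: integrable_fin_num => //; exact: density_integrableX. Qed.

Let marginYE y : (marginY y)%:E = \int[muX]_x (pi (x, y))%:E.
Proof. by rewrite fineK//; apply: integrable_fin_num => //; exact: density_integrableY. Qed.

Let mpi : measurable_fun setT (EFin \o pi).
Proof. by apply/measurable_EFinP; exact: measurable_density. Qed.

Let pi0 z : 0 <= (EFin \o pi) z. Proof. by rewrite lee_fin density_ge0. Qed.

Let measurable_marginX : measurable_fun setT marginX.
Proof.
apply/measurable_EFinP; rewrite (_ : _ \o _ = fubini_F muY (EFin \o pi)).
  exact: measurable_fun_fubini_tonelli_F.
by apply/funext => x; rewrite /= marginXE.
Qed.

Let measurable_marginY : measurable_fun setT marginY.
Proof.
apply/measurable_EFinP; rewrite (_ : _ \o _ = fubini_G muX (EFin \o pi)).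
  exact: measurable_fun_fubini_tonelli_G.
by apply/funext => y; rewrite /= marginYE.
Qed.

Let measurable_inv (d : measure_display) (T : measurableType d) (f : T -> R) :
  (forall t, 0 < f t)%R -> measurable_fun setT f ->
  measurable_fun setT (fun t => (f t)^-1%R).
Proof.
move=> f0 mf.
apply: (@measurable_comp _ _ _ _ _ _ [set r : R | r != 0%R]) => //.
- exact: open_measurable.
- by move=> _ [t _ <-]; rewrite /= gt_eqF.
- apply: open_continuous_measurable_fun => //; apply/in_setP => x /= x0.
  exact: inv_continuous.
Qed.

Lemma measurable_condX : measurable_fun setT (fun z : X * Y => condX z.1 z.2).
Proof.
apply: measurable_funM.
  by under eq_fun do rewrite -surjective_pairing; exact: measurable_density.
apply: (measurableT_comp (f := fun y => (marginY y)^-1%R)) => //.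
by apply: measurable_inv => // y; exact: density_marginY_gt0.
Qed.

Lemma measurable_condY : measurable_fun setT (fun z : X * Y => condY z.2 z.1).
Proof.
apply: measurable_funM.
  by under eq_fun do rewrite -surjective_pairing; exact: measurable_density.
apply: (measurableT_comp (f := fun x => (marginX x)^-1%R)) => //.
by apply: measurable_inv => // x; exact: density_marginX_gt0.
Qed.

Lemma condX_ge0 x y : (0 <= condX x y)%R.
Proof. by rewrite divr_ge0 ?density_ge0// ltW// density_marginY_gt0. Qed.

Lemma condY_ge0 y x : (0 <= condY y x)%R.
Proof. by rewrite divr_ge0 ?density_ge0// ltW// density_marginX_gt0. Qed.

Lemma integral_condX y : \int[muX]_x (condX x y)%:E = 1.
Proof.
under eq_integral do rewrite /condX EFinM.
rewrite integralZr//; last exact: density_integrableY.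
rewrite -marginYE -EFinM divff// gt_eqF//; exact: density_marginY_gt0.
Qed.

Lemma integral_condY x : \int[muY]_y (condY y x)%:E = 1.
Proof.
under eq_integral do rewrite /condY EFinM.
rewrite integralZr//; last exact: density_integrableX.
rewrite -marginXE -EFinM divff// gt_eqF//; exact: density_marginX_gt0.
Qed.

Let measurable_kX :
  measurable_fun setT (fun w : X * X => marginal_density w.2 w.1).
Proof.
apply: (@measurable_fun_fubini_tonelli_F _ _ _ _ _ muY
  (fun u : (X * X) * Y => (condX u.1.2 u.2 * condY u.2 u.1.1)%:E)).
  apply/measurable_EFinP; apply: measurable_funM.
    apply: (measurableT_comp measurable_condX (g := fun u => (u.1.2, u.2))).
    by apply: measurable_fun_pair => //; apply: measurableT_comp.
  apply: (measurableT_comp measurable_condY (g := fun u => (u.1.1, u.2))).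
  by apply: measurable_fun_pair => //; apply: measurableT_comp.
by move=> u; rewrite lee_fin mulr_ge0 ?condX_ge0 ?condY_ge0.
Qed.

Let kX_ge0 x' x : 0 <= marginal_density x' x.
Proof.
by apply: integral_ge0 => y _; rewrite lee_fin mulr_ge0 ?condX_ge0 ?condY_ge0.
Qed.

Let measurable_kX1 x : measurable_fun setT (marginal_density ^~ x).
Proof. exact: (measurableT_comp measurable_kX (pair1_measurable x)). Qed.

Let measurable_condX1 y : measurable_fun setT (condX ^~ y).
Proof. exact: (measurableT_comp measurable_condX (pair2_measurable y)). Qed.

Let measurable_condY1 x : measurable_fun setT (condY ^~ x).
Proof. exact: (measurableT_comp measurable_condY (pair1_measurable x)). Qed.

Let marginal_chain0 x : marginal_chain x set0 = 0.
Proof. exact: integral_set0. Qed.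

Let marginal_chain_ge0 x A : 0 <= marginal_chain x A.
Proof. exact: integral_ge0. Qed.

Let marginal_chain_sigma_additive x : semi_sigma_additive (marginal_chain x).
Proof. exact: integral_ge0_sigma_additive. Qed.

HB.instance Definition _ x := isMeasure.Build _ _ _ (marginal_chain x)
  (marginal_chain0 x) (@marginal_chain_ge0 x) (@marginal_chain_sigma_additive x).

Definition P_X : X -> {measure set X -> \bar R} := marginal_chain.

Let measurable_P_X A : measurable A -> measurable_fun setT (P_X ^~ A).
Proof.
by move=> mA; apply: (measurable_fun_integral_in muX measurable_kX).
Qed.

HB.instance Definition _ := isKernel.Build _ _ X X R P_X measurable_P_X.

Let P_X_setT x : P_X x setT = 1.
Proof.
rewrite /P_X/= /marginal_chain /marginal_density.
rewrite (@fubini_tonelli _ _ _ _ _ muX muY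
  (fun w : X * Y => (condX w.1 w.2 * condY w.2 x)%:E)); last 2 first.
- apply/measurable_EFinP; apply: measurable_funM; first exact: measurable_condX.
  exact: (measurableT_comp (measurable_condY1 x)).
- by move=> u; rewrite lee_fin mulr_ge0 ?condX_ge0 ?condY_ge0.
rewrite -(integral_condY x); apply: eq_integral => y _; rewrite /fubini_G/=.
under eq_integral do rewrite EFinM.
rewrite ge0_integralZr ?integral_condX ?mul1e//.
- exact/measurable_EFinP/measurable_condX1.
- by move=> x' _; rewrite lee_fin condX_ge0.
- by rewrite lee_fin condY_ge0.
Qed.

HB.instance Definition _ := Kernel_isProbability.Build _ _ X X R P_X P_X_setT.

Let dgs_ge0 (z w : X * Y) : 0 <= (condX w.1 z.2 * condY w.2 w.1)%:E.
Proof. by rewrite lee_fin mulr_ge0 ?condX_ge0 ?condY_ge0. Qed.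

Let measurable_dgs1 (z : X * Y) : measurable_fun setT
  (fun w : X * Y => (condX w.1 z.2 * condY w.2 w.1)%:E).
Proof.
apply/measurable_EFinP; apply: measurable_funM; last exact: measurable_condY.
exact: (measurableT_comp (measurable_condX1 z.2)).
Qed.

Let deterministic_scan0 z : deterministic_scan z set0 = 0.
Proof. exact: integral_set0. Qed.

Let deterministic_scan_ge0 z A : 0 <= deterministic_scan z A.
Proof. exact: integral_ge0. Qed.

Let deterministic_scan_sigma_additive z :
  semi_sigma_additive (deterministic_scan z).
Proof. exact: integral_ge0_sigma_additive. Qed.

HB.instance Definition _ z := isMeasure.Build _ _ _ (deterministic_scan z)
  (deterministic_scan0 z) (@deterministic_scan_ge0 z)
  (@deterministic_scan_sigma_additive z).

Definition P_DGS : X * Y -> {measure set (X * Y) -> \bar R} := deterministic_scan.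

Let measurable_P_DGS A : measurable A -> measurable_fun setT (P_DGS ^~ A).
Proof.
move=> mA.
pose g (u : (X * Y) * X * Y) : \bar R :=
  (\1_A (u.1.2, u.2) * (condX u.1.2 u.1.1.2 * condY u.2 u.1.2))%:E.
have mg : measurable_fun setT g.
  apply/measurable_EFinP; apply: measurable_funM.
    apply: (measurableT_comp (measurable_indic mA) (g := fun u => (u.1.2, u.2))).
    by apply: measurable_fun_pair => //; apply: measurableT_comp.
  apply: measurable_funM.
    apply: (measurableT_comp measurable_condX (g := fun u => (u.1.2, u.1.1.2))).
    apply: measurable_fun_pair; apply: measurableT_comp => //.
    exact: measurableT_comp.
  apply: (measurableT_comp measurable_condY (g := fun u => (u.1.2, u.2))).
  by apply: measurable_fun_pair => //; apply: measurableT_comp.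
have g0 u : 0 <= g u.
  by rewrite /g lee_fin; apply: mulr_ge0 => //; rewrite mulr_ge0 ?condX_ge0 ?condY_ge0.
have mh : measurable_fun setT (fubini_F muY g).
  exact: measurable_fun_fubini_tonelli_F.
have h0 w : 0 <= fubini_F muY g w by exact: integral_ge0.
have mk : measurable_fun setT (fubini_F muX (fubini_F muY g)).
  exact: measurable_fun_fubini_tonelli_F.
apply: eq_measurable_fun mk => z _; rewrite /P_DGS/= /deterministic_scan.
rewrite [RHS]integral_mkcond [RHS]fubini_tonelli1; last 2 first.
- exact: ((measurable_restrictT _ mA).1 (measurable_funTS (measurable_dgs1 z))).
- by move=> w; apply: erestrict_ge0.
apply: eq_integral => x' _; apply: eq_integral => y' _.
rewrite patchE /g indicE/=; case: ifPn => _; by rewrite ?mul1r ?mul0r.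
Qed.

HB.instance Definition _ := isKernel.Build _ _ _ _ R P_DGS measurable_P_DGS.

Let P_DGS_setT z : P_DGS z setT = 1.
Proof.
rewrite /P_DGS/= /deterministic_scan fubini_tonelli1//.
rewrite -(integral_condX z.2); apply: eq_integral => x' _; rewrite /fubini_F/=.
under eq_integral do rewrite EFinM.
rewrite ge0_integralZl ?integral_condY ?mule1//.
- exact/measurable_EFinP/measurable_condY1.
- by move=> y' _; rewrite lee_fin condY_ge0.
- by rewrite lee_fin condX_ge0.
Qed.

HB.instance Definition _ :=
  Kernel_isProbability.Build _ _ _ _ R P_DGS P_DGS_setT.

Section random_scan.
Variables (p : R) (p01 : (0 < p < 1)%R).

Let p_ge0 : (0 <= p)%R. Proof. by case/andP : p01 => /ltW. Qed.

Let onemp_ge0 : (0 <= 1 - p)%R.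
Proof. by case/andP : p01 => _ /ltW; rewrite subr_ge0. Qed.

Let random_scanE z A : random_scan p z A =
  p%:E * \int[muX]_(x' in (pair^~ z.2) @^-1` A) (condX x' z.2)%:E +
  (1 - p)%:E * \int[muY]_(y' in (pair z.1) @^-1` A) (condY y' z.1)%:E.
Proof.
congr (_ * _ + _ * _); rewrite [RHS]integral_mkcond; apply: eq_integral => t _.
- rewrite patchE indicE; have [|] := boolP (_ \in A).
    by rewrite inE => At; rewrite mem_set ?mul1r.
  by rewrite notin_setE => At; rewrite memNset ?mul0r.
- rewrite patchE indicE; have [|] := boolP (_ \in A).
    by rewrite inE => At; rewrite mem_set ?mul1r.
  by rewrite notin_setE => At; rewrite memNset ?mul0r.
Qed.

Let random_scan0 z : random_scan p z set0 = 0.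
Proof. by rewrite random_scanE !preimage_set0 !integral_set0 !mule0 adde0. Qed.

Let random_scan_ge0 z A : 0 <= random_scan p z A.
Proof.
rewrite random_scanE; apply: adde_ge0; apply: mule_ge0;
  rewrite ?lee_fin//; apply: integral_ge0 => t _; rewrite lee_fin.
- exact: condX_ge0.
- exact: condY_ge0.
Qed.

Let measurable_preimage_pair1 (x : X) (A : set (X * Y)) : measurable A ->
  measurable (pair x @^-1` A).
Proof. by move=> mA; rewrite -[_ @^-1` _]setTI; exact: pair1_measurable. Qed.

Let measurable_preimage_pair2 (y : Y) (A : set (X * Y)) : measurable A ->
  measurable (pair^~ y @^-1` A).
Proof. by move=> mA; rewrite -[_ @^-1` _]setTI; exact: pair2_measurable. Qed.

Let random_scan_sigma_additive z : semi_sigma_additive (random_scan p z).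
Proof.
move=> F mF tF mUF.
have tp T (f : T -> X * Y) : trivIset setT (fun n => f @^-1` F n).
  apply/trivIsetP => i j _ _ ij; rewrite -preimage_setI.
  by move/trivIsetP : tF => /(_ _ _ Logic.I Logic.I ij) ->; rewrite preimage_set0.
suff -> : random_scan p z (\bigcup_n F n) = \sum_(n <oo) random_scan p z (F n).
  by apply: is_cvg_ereal_nneg_natsum => n _; exact: random_scan_ge0.
rewrite random_scanE !preimage_bigcup ge0_integral_bigcup//; last 3 first.
- by move=> n; exact: measurable_preimage_pair2.
- by apply: measurable_funTS; apply/measurable_EFinP; exact: measurable_condX1.
- by move=> t _; rewrite lee_fin condX_ge0.
rewrite ge0_integral_bigcup//; last 3 first.
- by move=> n; exact: measurable_preimage_pair1.
- by apply: measurable_funTS; apply/measurable_EFinP; exact: measurable_condY1.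
- by move=> t _; rewrite lee_fin condY_ge0.
have h1 i : 0 <= \int[muX]_(x' in (pair^~ z.2) @^-1` F i) (condX x' z.2)%:E.
  by apply: integral_ge0 => t _; rewrite lee_fin condX_ge0.
have h2 i : 0 <= \int[muY]_(y' in (pair z.1) @^-1` F i) (condY y' z.1)%:E.
  by apply: integral_ge0 => t _; rewrite lee_fin condY_ge0.
rewrite -!nneseriesZl// -nneseriesD//; last 2 first.
- by move=> i _ _; rewrite mule_ge0// lee_fin.
- by move=> i _ _; rewrite mule_ge0// lee_fin.
by apply: eq_eseriesr => i _; rewrite random_scanE.
Qed.

HB.instance Definition _ z := isMeasure.Build _ _ _ (random_scan p z)
  (random_scan0 z) (@random_scan_ge0 z) (@random_scan_sigma_additive z).

Definition P_RGS : X * Y -> {measure set (X * Y) -> \bar R} :=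
  random_scan p.

Let measurable_P_RGS A : measurable A -> measurable_fun setT (P_RGS ^~ A).
Proof.
move=> mA.
pose fX (w : X * Y) : \bar R := (\1_A w * condX w.1 w.2)%:E.
pose fY (w : X * Y) : \bar R := (\1_A w * condY w.2 w.1)%:E.
have mfX : measurable_fun setT fX.
  apply/measurable_EFinP; apply: measurable_funM; last exact: measurable_condX.
  exact: measurable_indic.
have mfY : measurable_fun setT fY.
  apply/measurable_EFinP; apply: measurable_funM; last exact: measurable_condY.
  exact: measurable_indic.
have fX0 w : 0 <= fX w by rewrite /fX lee_fin mulr_ge0// condX_ge0.
have fY0 w : 0 <= fY w by rewrite /fY lee_fin mulr_ge0// condY_ge0.
have mGX : measurable_fun setT (fubini_G muX fX).
  exact: measurable_fun_fubini_tonelli_G.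
have mFY : measurable_fun setT (fubini_F muY fY).
  exact: measurable_fun_fubini_tonelli_F.
apply: emeasurable_funD; apply: measurable_funeM.
- exact: (measurableT_comp mGX).
- exact: (measurableT_comp mFY).
Qed.

HB.instance Definition _ :=
  isKernel.Build _ _ _ _ R (P_RGS) measurable_P_RGS.

Let P_RGS_setT z : P_RGS z setT = 1.
Proof.
rewrite /P_RGS/= random_scanE !preimage_setT integral_condX integral_condY.
by rewrite !mule1 -EFinD subrKC.
Qed.

HB.instance Definition _ :=
  Kernel_isProbability.Build _ _ _ _ R (P_RGS) P_RGS_setT.

End random_scan.

End gibbs.

(* Main.v *)
(* Harris' theorem. Write T for the action of a kernel on functions. Suppose that
   T W <= rho W + K with rho < 1 and that on every set {W <= r} the m-step laws
   from two points overlap by a fixed amount. Then, as in Hairer and Mattingly's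
   proof, the iterates of a [0, 1]-valued function become geometrically flat with
   respect to the weight 2 + b W(x) + b W(y); integrating against the invariant
   law gives geometric ergodicity with M = C (1 + W).

   The overlap for P_X comes from the Feller property. Its laws are mutually
   absolutely continuous, so the space is the union over n of the closed sets
   D_n of the x with nu(F) <= (n + 1) P_X(x, F) + 1/3 for all closed F, where nu
   is a fixed law of the chain. By Baire's theorem some D_n contains a nonempty
   relatively open subset of the support of nu, that is, up to a null set, a set
   O that is open. As x |-> P_X(x, O) is positive and lower semicontinuous, it is
   bounded below on compact sets, in particular on {V <= r}.

   An iterate of P_DGS is an iterate of P_X between a draw of x given y and a draw
   of y given x, so its convergence follows by integrating the bound for P_X.
   Finally P_RGS^2 >= p (1 - p) P_DGS transfers the overlap to P_RGS, and P_RGS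
   satisfies the drift condition for V + e G with a suitable e; the sublevel sets
   of V + e G lie in those of V + c G up to a change of the level. *)

Require Import Defs.
From HB Require Import structures.
From mathcomp Require Import all_boot all_order all_algebra.
From mathcomp Require Import all_classical all_reals all_analysis.
From mathcomp Require Import measurable_realfun lebesgue_Rintegral.
From mathcomp Require Import lra.

Set Implicit Arguments.
Unset Strict Implicit.
Unset Printing Implicit Defensive.
Import Order.TTheory GRing.Theory Num.Theory.
Import numFieldNormedType.Exports.
Local Open Scope classical_set_scope.
Local Open Scope ring_scope.
Local Open Scope ereal_scope.

(** * Weighted Lipschitz functions and overlapping means *)

Section mean.
Context {d : measure_display} {Z : measurableType d} {R : realType}.
Implicit Types (F G : Z -> \bar R) (f g : Z -> R) (E : (Z -> \bar R) -> \bar R).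

Definition nnmfun F : Prop := measurable_fun [set: Z] F /\ forall z, 0 <= F z.

(* A positive normalized linear functional, as a functional on the measurable
   functions with values in [0, +oo]; its values elsewhere are irrelevant. *)
Record mean E : Prop := Mean {
  mean1 : E (cst 1) = 1 ;
  le_mean : forall F G, nnmfun F -> nnmfun G -> (forall z, F z <= G z) ->
    E F <= E G ;
  meanD : forall F G, nnmfun F -> nnmfun G -> E (F \+ G) = E F + E G ;
  meanZ : forall (k : R) F, (0 <= k)%R -> nnmfun F ->
    E (fun z => k%:E * F z) = k%:E * E F }.

(** For two laws, the infimum of the right-hand side over all such pairs is the mass of their
    minimum, that is, one minus the largest difference of their values on a set. Pairs with sum 1
    avoid subtraction in the extended reals. *)
Definition overlap (a : R) E1 E2 := forall F G, nnmfun F -> nnmfun G ->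
  (forall z, F z + G z = 1) -> a%:E <= E1 F + E2 G.

Lemma nnmfun_cst (k : R) : (0 <= k)%R -> nnmfun (cst k%:E).
Proof. by move=> k0; split => // z; rewrite lee_fin. Qed.

Lemma nnmfunD F G : nnmfun F -> nnmfun G -> nnmfun (F \+ G).
Proof.
by move=> [mF F0] [mG G0]; split => [|z]; [exact: emeasurable_funD|exact: adde_ge0].
Qed.

Lemma nnmfunZ (k : R) F : (0 <= k)%R -> nnmfun F -> nnmfun (fun z => k%:E * F z).
Proof.
move=> k0 [mF F0]; split => [|z]; first exact: measurable_funeM.
by rewrite mule_ge0.
Qed.

Lemma nnmfun_EFin f : measurable_fun setT f -> (forall z, 0 <= f z)%R ->
  nnmfun (EFin \o f).
Proof. by move=> mf f0; split => [|z]; [exact/measurable_EFinP|rewrite lee_fin]. Qed.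

Lemma nnmfun_indic (A : set Z) : measurable A -> nnmfun (EFin \o \1_A).
Proof. by move=> mA; apply: nnmfun_EFin => // z; rewrite indicE. Qed.

Lemma nnmfun_onem F : nnmfun F -> (forall z, F z <= 1) ->
  nnmfun (fun z => 1 - F z) /\ forall z, F z + (1 - F z) = 1.
Proof.
move=> [mF F0] F1; split; last first.
  move=> z; rewrite addeC subeK// ge0_fin_numE//.
  exact: le_lt_trans (F1 z) (ltry _).
split => [|z]; first exact: emeasurable_funB.
by move: (F0 z) (F1 z); case: (F z) => //= r _; rewrite -EFinB !lee_fin subr_ge0.
Qed.

Section mean_theory.
Variables (E : (Z -> \bar R) -> \bar R) (mE : mean E).

Lemma mean_ge0 F : nnmfun F -> 0 <= E F.
Proof.
move=> nF; have <- : E (fun z => 0%:E * F z) = 0 by rewrite meanZ// mul0e.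
apply: le_mean => //; first exact: nnmfunZ.
by move=> z; rewrite mul0e; case: nF.
Qed.

Lemma mean_cst (k : R) : (0 <= k)%R -> E (cst k%:E) = k%:E.
Proof.
move=> k0; have <- : (fun z : Z => k%:E * cst 1 z) = cst k%:E.
  by apply/funext => z; rewrite mule1.
rewrite (meanZ mE k0 (F := cst 1)) ?(mean1 mE) ?mule1//.
Qed.

Lemma mean_le1 F : nnmfun F -> (forall z, F z <= 1) -> E F <= 1.
Proof.
move=> nF F1; rewrite -(mean1 mE); exact: le_mean.
Qed.

Lemma mean_fin_num F : nnmfun F -> (forall z, F z <= 1) -> E F \is a fin_num.
Proof.
move=> nF F1; rewrite ge0_fin_numE ?mean_ge0//.
by apply: le_lt_trans (mean_le1 nF F1) _; rewrite ltry.
Qed.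

Lemma mean_affine (k l : R) f : (0 <= k)%R -> (0 <= l)%R ->
  measurable_fun setT f -> (forall z, 0 <= f z)%R ->
  E (fun z => (k + l * f z)%:E) = k%:E + l%:E * E (EFin \o f).
Proof.
move=> k0 l0 mf f0; have nf := nnmfun_EFin mf f0.
rewrite -(meanZ mE l0 nf) -[in RHS](mean_cst k0) -(meanD mE) //.
exact: nnmfunZ.
Qed.

End mean_theory.

Section truncation.
Variables (f V : Z -> R) (a b : R).
Hypotheses (mf : measurable_fun setT f) (mV : measurable_fun setT V).
Hypotheses (f0 : forall z, (0 <= f z)%R) (V0 : forall z, (0 <= V z)%R).
Hypotheses (a0 : (0 < a)%R) (b0 : (0 <= b)%R).
Hypothesis lip : forall x y, (f x <= f y + a * (2 + b * V x + b * V y))%R.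

(** By [lip] the intervals of centre [f z] and radius [a * (1 + b * V z)] meet pairwise, so the
    infimum of their right ends lies in all of them. Clipping [f] to within distance [a] of this
    common point moves [f z] by at most [a * b * V z]; [h] is the clipped function rescaled to
    [0, 1]. As [f] is nonnegative, so is the lower clipping level [k], as the laws of [mean]
    require. *)
Lemma weighted_lipschitz_truncation : exists (k : R) (h : Z -> R),
  [/\ (0 <= k)%R /\ measurable_fun setT h, (forall z, 0 <= h z <= 1)%R,
      (forall z, f z <= k + 2 * a * h z + a * b * V z)%R &
      (forall z, k + 2 * a * h z <= f z + a * b * V z)%R].
Proof.
pose S := [set (f y + a * (1 + b * V y))%R | y in [set: Z]].
have S0 : S !=set0 by exists (f point + a * (1 + b * V point))%R; exists point.
have bV z : (0 <= a * b * V z)%R by rewrite !mulr_ge0// ltW.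
have lbS : lbound S a by move=> _ [y _ <-]; have := f0 y; have := bV y; lra.
have hS : has_inf S by split => //; exists a.
have ca : (a <= inf S)%R by exact: lb_le_inf.
have cle z : (inf S <= f z + a * (1 + b * V z))%R by apply: ge_inf; [case: hS|exists z].
have cge z : (f z - a * (1 + b * V z) <= inf S)%R.
  by apply: lb_le_inf => // _ [y _ <-]; have := lip z y; lra.
set c := inf S in ca cle cge.
pose m z := Num.min (Num.max (f z) (c - a)%R) (c + a)%R.
have mP z : [/\ (c - a <= m z)%R, (m z <= c + a)%R,
    (f z <= m z + a * b * V z)%R & (m z <= f z + a * b * V z)%R].
  have := a0; have := cge z; have := cle z; have := bV z; rewrite /m.
  case: (ltrP (f z) (c - a)) => ?.
    by case: (ltrP (c - a)%R (c + a)) => ?; split; lra.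
  by case: (ltrP (f z) (c + a)) => ?; split; lra.
pose h z := ((m z - (c - a)) / (2 * a))%R.
have hE z : (2 * a * h z = m z - (c - a))%R.
  by rewrite mulrC divfK// gt_eqF// mulr_gt0.
exists (c - a)%R, h; split.
- split; first by rewrite subr_ge0.
  apply: measurable_funM => //; apply: measurable_funB => //.
  by apply: measurable_minr => //; exact: measurable_maxr.
- move=> z; have [? ? _ _] := mP z; rewrite /h ler_pdivrMr ?mulr_gt0//.
  apply/andP; split; last by move: a0; lra.
  by apply: divr_ge0; move: a0; lra.
- by move=> z; rewrite hE; case: (mP z); lra.
- by move=> z; rewrite hE; case: (mP z); lra.
Qed.

(* Hairer and Mattingly's argument: the truncation [h] is controlled by the
   overlap, the rest by the weight [V]. *)
Lemma weighted_lipschitz_mean E1 E2 (al v1 v2 : R) : mean E1 -> mean E2 ->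
  (forall z, f z <= 1)%R ->
  overlap al E1 E2 -> E1 (EFin \o V) <= v1%:E -> E2 (EFin \o V) <= v2%:E ->
  E1 (EFin \o f) <= E2 (EFin \o f) + (a * (2 * (1 - al) + b * (v1 + v2)))%:E.
Proof.
move=> mE1 mE2 f1 ov E1V E2V.
have [k [h [[k0 mh] h01 fh hf]]] := weighted_lipschitz_truncation.
have h0 z : (0 <= h z)%R by case/andP: (h01 z).
have h1 z : (EFin \o h) z <= 1 by rewrite lee_fin; case/andP: (h01 z).
have nh := nnmfun_EFin mh h0.
have nV := nnmfun_EFin mV V0.
have nf := nnmfun_EFin mf f0.
have ab0 : (0 <= a * b)%R by rewrite mulr_ge0// ltW.
have a20 : (0 <= 2 * a)%R by rewrite mulr_ge0// ltW.
have nkh : nnmfun (fun z => (k + 2 * a * h z)%:E).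
  apply: (@nnmfun_EFin (fun z => k + 2 * a * h z)%R) => [|z].
  - by apply: measurable_funD => //; exact: measurable_funM.
  - by rewrite addr_ge0 ?mulr_ge0// ltW.
have nabV : nnmfun (fun z => (a * b)%:E * (EFin \o V) z) by exact: nnmfunZ.
have le1 : E1 (EFin \o f) <=
    k%:E + (2 * a)%:E * E1 (EFin \o h) + (a * b)%:E * E1 (EFin \o V).
  rewrite -(mean_affine mE1)// -(meanZ mE1)// -(meanD mE1)//.
  by apply: le_mean => //; exact: nnmfunD.
have le2 : k%:E + (2 * a)%:E * E2 (EFin \o h) <=
    E2 (EFin \o f) + (a * b)%:E * E2 (EFin \o V).
  rewrite -(mean_affine mE2)// -(meanZ mE2)// -(meanD mE2)//.
  by apply: le_mean => //; exact: nnmfunD.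
have [n1h sh] := nnmfun_onem nh h1.
(* The overlap is tested on [1 - h] under [E1] and on [h] under [E2]: it gives
   [E1 h <= E2 h + 1 - al]. *)
have := ov _ _ n1h nh (fun z => etrans (addeC _ _) (sh z)).
have : E1 (EFin \o h) + E1 (fun z => 1 - (EFin \o h) z) = 1.
  by rewrite -(meanD mE1)// -[RHS](mean1 mE1); congr E1; apply/funext => z; exact: sh.
have n1h1 z : 1 - (EFin \o h) z <= 1 by rewrite -EFinB lee_fin gerBl.
have V1fin : E1 (EFin \o V) \is a fin_num.
  by rewrite ge0_fin_numE ?(mean_ge0 mE1)//; exact: le_lt_trans E1V (ltry _).
have V2fin : E2 (EFin \o V) \is a fin_num.
  by rewrite ge0_fin_numE ?(mean_ge0 mE2)//; exact: le_lt_trans E2V (ltry _).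
move: le1 le2 E1V E2V.
rewrite -(fineK (mean_fin_num mE1 nf f1)) -(fineK (mean_fin_num mE2 nf f1)).
rewrite -(fineK (mean_fin_num mE1 nh h1)) -(fineK (mean_fin_num mE2 nh h1)).
rewrite -(fineK V1fin) -(fineK V2fin) -(fineK (mean_fin_num mE1 n1h n1h1)).
rewrite -!EFinM -!EFinD !lee_fin => le1 le2 E1V E2V [] eh leh.
have eh1 : (2 * a * fine (E1 (EFin \o h)) <=
            2 * a * (fine (E2 (EFin \o h)) + (1 - al)))%R.
  by apply: ler_wpM2l => //; lra.
have := ler_wpM2l ab0 E1V; have := ler_wpM2l ab0 E2V; lra.
Qed.
End truncation.

End mean.

(** * Harris' theorem *)

Section markov_op.
Context {d : measure_display} {Z : measurableType d} {R : realType}.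
Implicit Types (F G : Z -> \bar R) (T : (Z -> \bar R) -> Z -> \bar R).

Definition markov_op T : Prop := (forall z, mean (T^~ z)) /\
  forall F, nnmfun F -> measurable_fun [set: Z] (T F).

Lemma markov_nnmfun T F : markov_op T -> nnmfun F -> nnmfun (T F).
Proof.
move=> [mT mTF] nF; split => [|z]; first exact: mTF.
exact: (mean_ge0 (mT z)).
Qed.

Lemma markov_le1 T F : markov_op T -> nnmfun F -> (forall z, F z <= 1) ->
  forall z, T F z <= 1.
Proof. by move=> [mT _] nF F1 z; exact: (mean_le1 (mT z)). Qed.

Lemma mean_comp T (E : (Z -> \bar R) -> \bar R) :
  markov_op T -> mean E -> mean (E \o T).
Proof.
move=> mT mE; have [mT1 _] := mT; split => /=.
- have -> : T (cst 1) = cst 1 by apply/funext => z; exact: mean1 (mT1 z).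
  exact: mean1.
- move=> F G nF nG FG; apply: (le_mean mE); try exact: markov_nnmfun.
  by move=> z; exact: (le_mean (mT1 z)).
- move=> F G nF nG; rewrite -(meanD mE); try exact: markov_nnmfun.
  by congr E; apply/funext => z; exact: (meanD (mT1 z)).
- move=> k F k0 nF; rewrite -(meanZ mE) //; last exact: markov_nnmfun.
  by congr E; apply/funext => z; exact: (meanZ (mT1 z)).
Qed.

Lemma markov_op_comp T1 T2 :
  markov_op T1 -> markov_op T2 -> markov_op (T1 \o T2).
Proof.
move=> mT1 mT2; split => [z|F nF].
  exact: (mean_comp mT2 (mT1.1 z)).
by case: mT1 => _; apply; exact: markov_nnmfun.
Qed.

Lemma mean_dirac (z : Z) : mean (fun F : Z -> \bar R => F z).
Proof. by split. Qed.

Lemma markov_op_iter n T : markov_op T -> markov_op (iter n T).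
Proof.
move=> mT; elim: n => [|n ih]; last exact: (markov_op_comp mT ih).
by split => [z|F []//]; exact: mean_dirac.
Qed.

Lemma mean_integral (mu : {measure set Z -> \bar R}) : mu setT = 1 ->
  mean (fun F => \int[mu]_z F z).
Proof.
move=> mu1; split.
- by rewrite integral_cst// mul1e.
- by move=> F G [mF F0] [mG G0] FG; apply: ge0_le_integral.
- by move=> F G [mF F0] [mG G0]; rewrite ge0_integralD.
- by move=> k F k0 [mF F0]; rewrite ge0_integralZl.
Qed.

(** The constant built by the induction is the sum of the [lam ^+ i * L] for [i < n]. Harris'
    argument is run for the [m]-th iterate, whose drift this provides. *)
Lemma iter_drift T (V : Z -> R) (lam L : R) : markov_op T ->
  measurable_fun setT V -> (forall z, 0 <= V z)%R ->
  (0 <= lam)%R -> (0 <= L)%R ->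
  (forall z, T (EFin \o V) z <= (lam * V z + L)%:E) ->
  forall n, exists2 K, (0 <= K)%R & forall z,
    iter n T (EFin \o V) z <= (lam ^+ n * V z + K)%:E.
Proof.
move=> mT mV V0 lam0 L0 TV; have nV := nnmfun_EFin mV V0.
elim=> [|n [K K0 ih]]; first by exists 0%R => // z; rewrite /= mul1r addr0.
exists (lam ^+ n * L + K)%R; first by rewrite addr_ge0 ?mulr_ge0 ?exprn_ge0.
move=> z; have [mTz _] := mT; have ln0 : (0 <= lam ^+ n)%R by rewrite exprn_ge0.
have nK : nnmfun (fun z => (K + lam ^+ n * V z)%:E).
  apply: (@nnmfun_EFin _ _ _ (fun z => K + lam ^+ n * V z)%R) => [|z'].
  - by apply: measurable_funD => //; exact: measurable_funM.
  - by rewrite addr_ge0 ?mulr_ge0.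
rewrite iterS (@le_trans _ _ (T (fun z => (K + lam ^+ n * V z)%:E) z))//.
  apply: (le_mean (mTz z)) => //; first exact: (markov_nnmfun (markov_op_iter n mT)).
  by move=> z'; rewrite addrC.
rewrite (mean_affine (mTz z))//.
rewrite (@le_trans _ _ (K%:E + (lam ^+ n)%:E * (lam * V z + L)%:E))//.
  by rewrite leeD2l// lee_wpmul2l.
by rewrite -EFinM -EFinD lee_fin exprSr; lra.
Qed.

End markov_op.

Lemma bernoulli_onem {R : realType} (x : R) (n : nat) : (0 <= x <= 1)%R ->
  (1 - n%:R * x <= (1 - x) ^+ n)%R.
Proof.
move=> /andP[x0 x1]; elim: n => [|n ih]; first by rewrite mul0r subr0 expr0.
rewrite exprS (@le_trans _ _ ((1 - x) * (1 - n%:R * x))%R)//; last first.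
  by rewrite ler_wpM2l// subr_ge0.
have := mulr_ge0 (ler0n R n) (mulr_ge0 x0 x0); rewrite -natr1; lra.
Qed.

Section harris.
Context {d : measure_display} {Z : measurableType d} {R : realType}.
Variables (T : (Z -> \bar R) -> Z -> \bar R) (V : Z -> R).
Hypotheses (mT : markov_op T) (mV : measurable_fun setT V).
Hypothesis V0 : forall z, (0 <= V z)%R.

(* The rate [1 - th] bounds the ratios obtained for small and for large values of
   [V x + V y]: for the small ones the overlap gains [al] while [2 b L = al], for
   the large ones the drift alone contracts. *)
Section contraction.
Variables (lam L al : R).
Hypotheses (lam01 : (0 <= lam < 1)%R) (L0 : (0 < L)%R) (al0 : (0 < al <= 1)%R).
Hypothesis TV : forall z, T (EFin \o V) z <= (lam * V z + L)%:E.
Hypothesis ov : forall x y, (V x + V y <= 4 * L / (1 - lam))%R ->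
  overlap al (T^~ x) (T^~ y).

Let b := (al / (2 * L))%R.
Let th := (al * (1 - lam) / (2 * (1 - lam + al)))%R.

Lemma markov_contraction_step (F : Z -> \bar R) (a : R) : nnmfun F ->
  (forall z, F z <= 1) -> (0 < a)%R ->
  (forall x y, F x <= F y + (a * (2 + b * V x + b * V y))%:E) ->
  forall x y, T F x <= T F y + ((1 - th) * a * (2 + b * V x + b * V y))%:E.
Proof.
move=> nF F1 a0 lip x y; have [mTz _] := mT.
have Ffin z : F z \is a fin_num.
  by rewrite ge0_fin_numE ?(le_lt_trans (F1 z)) ?ltry//; case: nF.
pose f := fine \o F; have Ff : F = EFin \o f by apply/funext => z; rewrite /= fineK.
have mf : measurable_fun setT f by apply: measurableT_comp => //; case: nF.
have f0 z : (0 <= f z)%R by rewrite fine_ge0//; case: nF.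
have b0 : (0 < b)%R by rewrite /b divr_gt0 ?mulr_gt0//; case/andP: al0.
have bL : (b * L * 2 = al)%R.
  by rewrite /b -mulrA [(L * 2)%R]mulrC divfK// gt_eqF// mulr_gt0.
have u0 : (0 < 1 - lam)%R by rewrite subr_gt0; case/andP: lam01.
have ua0 : (0 < 1 - lam + al)%R by rewrite (addr_gt0 u0)//; case/andP: al0.
have thE : (th * (2 * (1 - lam + al)) = al * (1 - lam))%R.
  by rewrite /th divfK// gt_eqF// mulr_gt0.
have step c : overlap c (T^~ x) (T^~ y) -> T F x <= T F y +
    (a * (2 * (1 - c) + b * ((lam * V x + L) + (lam * V y + L))))%:E.
  move=> ovc; rewrite Ff; apply: (weighted_lipschitz_mean mf mV f0 V0 a0 (ltW b0)
    _ (mTz x) (mTz y) _ ovc) => //.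
  - move=> z z'; rewrite -lee_fin EFinD; have := lip z z'.
    by rewrite Ff.
  - by move=> z; have := F1 z; rewrite Ff.
suff [c ovc le] : exists2 c, overlap c (T^~ x) (T^~ y) &
    (2 * (1 - c) + b * ((lam * V x + L) + (lam * V y + L)) <=
     (1 - th) * (2 + b * V x + b * V y))%R.
  apply: le_trans (step c ovc) _.
  by rewrite leeD2l// lee_fin; have := ler_wpM2l (ltW a0) le; lra.
case/andP: al0 => al_gt0 al1; case/andP: lam01 => lam0 lam1.
have bV z : (0 <= b * V z)%R by rewrite mulr_ge0// ltW.
have th0 : (0 <= th)%R.
  by apply/ltW/divr_gt0; exact: mulr_gt0.
have thal : (0 <= al - 2 * th)%R.
  rewrite -(pmulr_lge0 _ ua0).
  have := mulr_ge0 (ltW al_gt0) (ltW al_gt0); move: thE; lra.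
have thu : (0 <= (1 - lam) - 2 * th)%R.
  rewrite -(pmulr_lge0 _ ua0).
  have := mulr_ge0 (ltW u0) (ltW u0); move: thE; lra.
have [s_le|s_gt] := lerP (V x + V y)%R (4 * L / (1 - lam))%R.
  exists al; first exact: ov.
  have := mulr_ge0 thu (bV x); have := mulr_ge0 thu (bV y).
  have := mulr_ge0 th0 (bV x); have := mulr_ge0 th0 (bV y).
  move: bL thal; lra.
exists 0%R.
  by move=> F' G' nF' nG' _; rewrite adde_ge0 ?(mean_ge0 (mTz _)).
have s_ge : (2 * al <= (1 - lam) * (b * V x + b * V y))%R.
  have : (4 * L <= (1 - lam) * (V x + V y))%R.
    by rewrite [leRHS]mulrC -ler_pdivrMr// ltW.
  by move=> /(ler_wpM2l (ltW b0)); move: bL; lra.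
set s := (b * V x + b * V y)%R in s_ge *.
have keyE : ((1 - lam - 2 * th) * (1 - lam + al) = (1 - lam) * (1 - lam))%R.
  by move: thE; lra.
(* [th] is the value that turns this into an equality at the smallest [s] allowed by [s_ge], namely
   [2 * al / (1 - lam)]. *)
have key : (4 * th <= (1 - lam - 2 * th) * s)%R.
  rewrite -(ler_pM2r ua0) [leRHS]mulrAC keyE.
  have := ler_wpM2l (ltW u0) s_ge; move: thE; lra.
move: key s_ge bL; rewrite /s; lra.
Qed.

(** At [q = 0] the bound holds because the weight is at least 2 and is halved, while [F] has values
    in [0, 1]; each application of [T] then gains a factor [1 - th]. *)
Lemma markov_contraction (F : Z -> \bar R) : nnmfun F ->
  (forall z, F z <= 1) -> forall q x y, iter q T F x <= iter q T F y +
    (2^-1 * (1 - th) ^+ q * (2 + b * V x + b * V y))%:E.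
Proof.
move=> nF F1; elim=> [|q ih] x y.
  have F0 : 0 <= F y by case: nF.
  have b0 : (0 <= b)%R by rewrite /b divr_ge0 ?mulr_ge0 ?ltW//; case/andP: al0.
  rewrite /= mulr1 (le_trans (F1 x))// -[leLHS]add0e leeD// lee_fin.
  have := mulr_ge0 b0 (V0 x); have := mulr_ge0 b0 (V0 y); lra.
have th1 : (0 < 1 - th)%R.
  case/andP: al0 => al_gt0 al1; case/andP: lam01 => lam0 lam1.
  have u0 : (0 < 1 - lam)%R by rewrite subr_gt0.
  have ua0 : (0 < 1 - lam + al)%R by rewrite (addr_gt0 u0).
  rewrite subr_gt0 /th ltr_pdivrMr ?mulr_gt0//.
  have := ler_wpM2r (ltW u0) al1; lra.
have mq := markov_op_iter q mT.
rewrite exprS mulrCA !iterS; apply: markov_contraction_step => //.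
- exact: markov_nnmfun.
- exact: markov_le1.
- by rewrite mulr_gt0 ?invr_gt0// exprn_gt0.
Qed.
End contraction.

End harris.

Lemma overlapW {d : measure_display} {Z : measurableType d} {R : realType}
    (a b : R) (E1 E2 : (Z -> \bar R) -> \bar R) :
  (a <= b)%R -> overlap b E1 E2 -> overlap a E1 E2.
Proof.
by move=> ab ov F G nF nG FG; apply: le_trans (ov F G nF nG FG); rewrite lee_fin.
Qed.

Section geometric_convergence.
Context {d : measure_display} {Z : measurableType d} {R : realType}.
Variables (T : (Z -> \bar R) -> Z -> \bar R) (V : Z -> R) (lam L : R) (m : nat)
  (w : (Z -> \bar R) -> \bar R).
Hypotheses (mT : markov_op T) (mV : measurable_fun setT V).
Hypotheses (V0 : forall z, (0 <= V z)%R) (lam01 : (0 < lam < 1)%R).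
Hypotheses (L0 : (0 <= L)%R) (m0 : (0 < m)%N).
Hypothesis TV : forall z, T (EFin \o V) z <= (lam * V z + L)%:E.
Hypothesis ov : forall c : R, exists2 al, (0 < al)%R & forall x y,
  (V x <= c)%R -> (V y <= c)%R -> overlap al (iter m T ^~ x) (iter m T ^~ y).

(** The contraction is applied to [iter m T]. When [n] is divided by [m], the remaining steps act
    first on [F] and keep it [0, 1]-valued. *)
Let iter_lipschitz : exists (b c t : R), [/\ (0 <= b)%R, (0 <= c)%R,
  (0 < t < 1)%R & forall F : Z -> \bar R, nnmfun F -> (forall z, F z <= 1) ->
  forall n x y, iter n T F x <= iter n T F y +
    (c * t ^+ n * (2 + b * V x + b * V y))%:E].
Proof.
have [lam_gt0 lam_lt1] := andP lam01.
have [K K0 TmV] := iter_drift mT mV V0 (ltW lam_gt0) L0 TV m.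
have lm01 : (0 <= lam ^+ m < 1)%R.
  by rewrite exprn_ge0 ?exprn_ilt1 ?(ltW lam_gt0)// -lt0n m0.
(* Adding 1 makes the drift constant positive, as the contraction requires. *)
have K1 : (0 < K + 1)%R by rewrite ltr_wpDl.
have {}TmV z : iter m T (EFin \o V) z <= (lam ^+ m * V z + (K + 1))%:E.
  by apply: le_trans (TmV z) _; rewrite lee_fin lerD2l lerDl.
have [al' al'0 ovc] := ov (4 * (K + 1) / (1 - lam ^+ m))%R.
pose al := Num.min al' 1%R.
have al01 : (0 < al <= 1)%R by rewrite /al lt_min al'0 ltr01/= ge_min lexx orbT.
have {}ovc x y : (V x + V y <= 4 * (K + 1) / (1 - lam ^+ m))%R ->
    overlap al (iter m T ^~ x) (iter m T ^~ y).
  move=> Vxy; apply: (@overlapW _ _ _ _ al'); first by rewrite /al ge_min lexx.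
  apply: ovc; apply: le_trans Vxy.
  - by rewrite lerDl.
  - by rewrite lerDr.
set b := (al / (2 * (K + 1)))%R.
set th := (al * (1 - lam ^+ m) / (2 * (1 - lam ^+ m + al)))%R.
have contr := markov_contraction (markov_op_iter m mT) mV V0 lm01 K1 al01 TmV ovc.
rewrite -/b -/th in contr.
have [al_gt0 al1] := andP al01; have [lm0 lm1] := andP lm01.
have u0 : (0 < 1 - lam ^+ m)%R by rewrite subr_gt0.
have ua0 : (0 < 1 - lam ^+ m + al)%R by rewrite (addr_gt0 u0).
have th0 : (0 < th)%R by apply: divr_gt0; exact: mulr_gt0.
have th1 : (th < 1)%R.
  rewrite /th ltr_pdivrMr ?mulr_gt0//.
  have := ler_wpM2r (ltW u0) al1; lra.
have mR : (0 < m%:R :> R)%R by rewrite ltr0n.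
(* Bernoulli's inequality gives [1 - th <= t ^+ m], avoiding an [m]-th root. *)
pose t := (1 - th / m%:R)%R.
have thm : (th / m%:R < 1)%R.
  rewrite ltr_pdivrMr// mul1r (lt_le_trans th1)//.
  by rewrite ler1n.
have t01 : (0 < t < 1)%R by rewrite /t subr_gt0 thm/= gtrBl divr_gt0.
have [t0 t1] := andP t01.
have tm : (1 - th <= t ^+ m)%R.
  have := @bernoulli_onem R (th / m%:R) m.
  rewrite [(m%:R * _)%R]mulrC divfK ?gt_eqF//; apply.
  by rewrite (ltW thm) divr_ge0// ltW.
(* The division by [t ^+ m] pays for the fewer than [m] steps left over by the full blocks of length
   [m]. *)
exists b, (2^-1 / t ^+ m)%R, t; split => //.
- by rewrite /b divr_ge0 ?mulr_ge0 ?(ltW al_gt0) ?(ltW K1).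
- by rewrite divr_ge0// exprn_ge0 ?ltW.
move=> F nF F1 n x y; rewrite (divn_eq n m) iterD iterM.
pose q := (n %/ m)%N; pose r := (n %% m)%N; rewrite -/q -/r.
have := contr _ (markov_nnmfun (markov_op_iter r mT) nF)
  (markov_le1 (markov_op_iter r mT) nF F1) q x y.
move=> /le_trans; apply; rewrite leeD2l// lee_fin.
have b0 : (0 <= b)%R by rewrite /b divr_ge0 ?mulr_ge0 ?(ltW al_gt0) ?(ltW K1).
apply: ler_wpM2r; first by rewrite !addr_ge0// mulr_ge0.
rewrite -mulrA ler_wpM2l// ler_pdivlMl ?exprn_gt0//.
apply: (@le_trans _ _ (t ^+ m * (t ^+ m) ^+ q)%R).
  rewrite ler_wpM2l ?exprn_ge0 ?(ltW t0)//.
  by apply: lerXn2r => //; rewrite nnegrE ?exprn_ge0// ?subr_ge0 ltW.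
rewrite -exprM -exprD ler_wiXn2l ?(ltW t0) ?(ltW t1)//.
by rewrite [leqRHS]addnC [(m * q)%N]mulnC leq_add2l ltnW// ltn_pmod.
Qed.

Hypotheses (mw : mean w) (wT : forall F, nnmfun F -> w (T F) = w F).
Hypothesis wV : w (EFin \o V) < +oo.

(** Integrating the Lipschitz bound in one of its two points against [w] replaces that iterate by
    [w F], by invariance, and [V] by its finite mean. The two inequalities come from the two choices
    of the point. *)
Lemma geometric_convergence : exists (C t : R), [/\ (0 <= C)%R,
  (0 < t < 1)%R & forall F : Z -> \bar R, nnmfun F -> (forall z, F z <= 1) ->
  forall n z, iter n T F z <= w F + (C * (1 + V z) * t ^+ n)%:E /\
    w F <= iter n T F z + (C * (1 + V z) * t ^+ n)%:E].
Proof.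
have [b [c [t [b0 c0 t01 lip]]]] := iter_lipschitz.
have [t0 t1] := andP t01.
have nV := nnmfun_EFin mV V0.
have wV0 : 0 <= w (EFin \o V) by exact: mean_ge0.
pose v := fine (w (EFin \o V)).
have wVE : w (EFin \o V) = v%:E by rewrite /v fineK// ge0_fin_numE.
have v0 : (0 <= v)%R by rewrite fine_ge0.
exists (c * (2 + b + b * v))%R, t; split => //.
  by rewrite mulr_ge0// !addr_ge0// mulr_ge0.
move=> F nF F1 n z.
have nTn := markov_nnmfun (markov_op_iter n mT) nF.
have Tn1 := markov_le1 (markov_op_iter n mT) nF F1.
have wTn : w (iter n T F) = w F.
  elim: n {nTn Tn1} => //= n ih; rewrite wT//.
  exact: (markov_nnmfun (markov_op_iter n mT)).
have Tnfin y : iter n T F y \is a fin_num.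
  by rewrite ge0_fin_numE ?(le_lt_trans (Tn1 y)) ?ltry//; case: nTn.
pose k := (c * t ^+ n * (2 + b * V z))%R.
have ct0 : (0 <= c * t ^+ n)%R by rewrite mulr_ge0// exprn_ge0// ltW.
have k0 : (0 <= k)%R by rewrite mulr_ge0// addr_ge0// mulr_ge0.
pose l := (c * t ^+ n * b)%R.
have l0 : (0 <= l)%R by rewrite mulr_ge0.
have final : (k + l * v <= c * (2 + b + b * v) * (1 + V z) * t ^+ n)%R.
  have := mulr_ge0 ct0 (V0 z); move=> h.
  have := mulr_ge0 l0 v0; have := mulr_ge0 h b0; have := mulr_ge0 (mulr_ge0 h b0) v0.
  move: h l0; rewrite /k /l; lra.
have nkl : nnmfun (fun y => (k + l * V y)%:E).
  apply: (@nnmfun_EFin _ _ _ (fun y => k + l * V y)%R) => [|y].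
  - by apply: measurable_funD => //; exact: measurable_funM.
  - by rewrite addr_ge0// mulr_ge0.
have wkl : w (fun y => (k + l * V y)%:E) = (k + l * v)%:E.
  by rewrite (mean_affine mw)// wVE.
split.
- have Tnz0 : (0 <= fine (iter n T F z))%R by rewrite fine_ge0//; case: nTn.
  apply: (@le_trans _ _ (w F + (k + l * v)%:E)); last by rewrite leeD2l// lee_fin.
  rewrite -{1}(fineK (Tnfin z)) -(mean_cst mw Tnz0) -wTn -wkl -(meanD mw)//.
  apply: (le_mean mw) => //; first exact: nnmfunD.
  move=> y /=; rewrite fineK//; apply: le_trans (lip F nF F1 n z y) _.
  by rewrite leeD2l// lee_fin /k /l; lra.
- have Tnz0 : (0 <= fine (iter n T F z))%R by rewrite fine_ge0//; case: nTn.
  apply: (@le_trans _ _ (iter n T F z + (k + l * v)%:E)); last first.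
    by rewrite leeD2l// lee_fin.
  rewrite -{1}(fineK (Tnfin z)) -(mean_cst mw Tnz0) -wTn -wkl -(meanD mw)//.
  apply: (le_mean mw) => //; first exact: nnmfunD.
  move=> y /=; rewrite fineK//; apply: le_trans (lip F nF F1 n y z) _.
  by rewrite leeD2l// lee_fin /k /l; lra.
Qed.

End geometric_convergence.

(** * Topology of the state spaces *)

(** Baire's argument relative to [S]. If no [D n] had interior in [S], there would be open sets
    [W n] meeting [S], the first inside a compact set, with the closure of [W n.+1] contained in
    [W n] minus [D n]. Points chosen in [W n] and [S] would then have a cluster point in [S] outside
    every [D n]. *)
Lemma baire_locally_compact {T : topologicalType} (S : set T)
    (D : nat -> set T) : locally_compact [set: T] -> regular_space T ->
  closed S -> S !=set0 -> (forall n, closed (D n)) -> S `<=` \bigcup_n D n ->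
  exists n, exists2 U : set T, open U /\ U `&` S !=set0 & U `&` S `<=` D n.
Proof.
move=> lcT regT clS [z0 Sz0] clD SD; apply: contrapT => /forallNP H.
have {}H n (U : set T) : open U -> U `&` S !=set0 ->
    exists2 z, (U `&` S) z & ~ D n z.
  move=> oU US; apply: contrapT => /forall2NP h; apply: (H n); exists U => //.
  by move=> z USz; have [//|/contrapT] := h z.
have step (n : nat) (W : set T) : exists W' : set T, open W -> W `&` S !=set0 ->
    [/\ open W', W' `&` S !=set0 & closure W' `<=` W `\` D n].
  (* The relation is made total in [W], so that a choice function exists; its value at other sets is
     arbitrary. *)
  have [[oW WS]|nW] := pselect (open W /\ W `&` S !=set0); last first.
    by exists set0 => oW WS; exfalso; exact: nW.
  have [z [Wz Sz] nDz] := H n W oW WS.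
  have oWD : open (W `\` D n) by apply: openI => //; exact: closed_openC.
  have /regT [B Bz BWD] : nbhs z (W `\` D n) by exact: open_nbhs_nbhs.
  exists B° => _ _; split; first exact: open_interior.
    by exists z.
  by apply: subset_trans BWD; apply: closureS; exact: interior_subset.
have [f fP] := choice (fun nW => step nW.1 nW.2).
have [K] := lcT z0 Logic.I; rewrite withinET => Kz0 [cptK _].
pose W := fix W n := if n is n'.+1 then f (n', W n') else K°.
have WP n : open (W n) /\ W n `&` S !=set0.
  elim: n => [|n [oW WS]]; first by split; [exact: open_interior|exists z0].
  by have [] := fP (n, W n) oW WS.
have Wcl n : closure (W n.+1) `<=` W n `\` D n.
  by have [oW WS] := WP n; have [] := fP (n, W n) oW WS.
have Wdec n m : W (n + m)%N `<=` W n.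
  elim: m => [|m ih]; first by rewrite addn0.
  rewrite addnS; apply: subset_trans ih => z Wz.
  by have [] := Wcl _ _ (subset_closure Wz).
have [z zP] := choice (fun n => (WP n).2).
have zW n : \forall m \near \oo, W n (z m).
  by exists n => // m /= nm; apply: (Wdec n (m - n)%N); rewrite subnKC//; case: (zP m).
have [|p [Kp clp]] := cptK (z @ \oo) _.
  by apply: filterS (zW 0%N) => n; exact: interior_subset.
have Sp : S p.
  apply: clS => B Bp; have zS : (z @ \oo) S by exists 0%N => // m _; case: (zP m).
  exact: clp zS Bp.
have [n _ Dp] := SD p Sp.
suff : (W n `\` D n) p by case.
by apply: Wcl => B Bp; exact: clp (zW n.+1) Bp.
Qed.

Lemma compact_nondecreasing_cover {T : topologicalType} (C : set T)
    (W : nat -> set T) : compact C -> (forall n, open (W n)) ->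
  {homo W : n m / (n <= m)%N >-> n `<=` m} -> C `<=` \bigcup_n W n ->
  exists n, C `<=` W n.
Proof.
move=> /compact_near_coveringP cptC oW Wnd CW.
suff : \forall n \near \oo, C `<=` W n.
  by move=> [n _ CWn]; exists n; apply: (CWn n) => /=.
apply: (cptC nat \oo (fun n z => W n z)) => z /CW[n _ Wnz].
exists (W n, [set m | (n <= m)%N]).
  by split => /=; [exact: open_nbhs_nbhs|exists n].
by move=> [z' m] [/= Wnz' nm]; exact: Wnd Wnz'.
Qed.

Section state_space_topology.
Context {R : realType} {U : pseudoMetricType R} {A : set U} {A0 : A !=set0}.
Local Notation Z := (state_space A0).

Lemma state_space_regular : regular_space Z.
Proof. exact: (@uniform_regular (initial_topology (@set_val U A))). Qed.

Lemma state_space_open_measurable (O : set Z) : open O -> measurable O.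
Proof. by move=> oO; exact: sub_sigma_algebra. Qed.

Lemma state_space_closed_measurable (F : set Z) : closed F -> measurable F.
Proof.
move=> cF; rewrite -[F]setCK; apply: measurableC.
by apply: state_space_open_measurable; exact: closed_openC.
Qed.

(** [G n] collects the points whose ball of radius [1 / n.+1] stays in the ambient open set [O']. A
    point of its closure is within that radius of a point of [G n], so it still lies in [O']; the
    closures therefore fill the trace of [O'] from inside and pull back to closed sets. *)
Lemma state_space_open_Fsigma (O : set Z) : open O -> exists F : nat -> set Z,
  [/\ forall n, closed (F n), {homo F : n m / (n <= m)%N >-> n `<=` m} &
      O = \bigcup_n F n].
Proof.
case=> O' oO' <-.
pose G n := [set u : U | ball u n.+1%:R^-1 `<=` O'].
exists (fun n => @set_val U A @^-1` closure (G n)); split.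
- move=> n; apply: (@preimage_closed _ _ (@set_val U A : Z -> U)); last first.
    exact: closed_closure.
  by move=> x _; exact: initial_continuous.
- move=> n m nm x /=; apply: closureS => u /= Gu; apply: subset_trans Gu.
  by apply: le_ball; rewrite lef_pV2 ?posrE// ler_nat.
- apply/seteqP; split => [x /= Ox|x [n _ /= clG]].
    have /nbhs_ballP[e /= e0 eO] : nbhs (set_val x) O' by exact: open_nbhs_nbhs.
    have [n ne] : exists n, (n.+1%:R^-1 < e :> R)%R.
      exists (Num.truncn e^-1); rewrite -[ltRHS]invrK ltf_pV2 ?posrE ?invr_gt0//.
      exact: Num.Theory.truncnS_gt.
    exists n => //; apply: subset_closure; apply: subset_trans eO.
    by apply: le_ball; exact: ltW.
  pose e : R := ((n.+1)%:R^-1)%R.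
  have e0 : (0 < e)%R by rewrite invr_gt0.
  have [u [Gu xu]] := clG _ (nbhsx_ballx (set_val x) e e0).
  by apply: Gu; exact: ball_sym.
Qed.

End state_space_topology.

(** * Regularity and support of Borel probabilities *)

Section unit_mass.
Context {d : measure_display} {T : measurableType d} {R : realType}.

(** Equips a measure of total mass 1, such as a single law of a kernel, with the structure that
    lemmas on probabilities expect. *)
Definition unit_mass_probability (mu : {measure set T -> \bar R})
  (mu1 : mu setT = 1) : set T -> \bar R := mu.

HB.instance Definition _ mu mu1 := Measure.on (@unit_mass_probability mu mu1).
HB.instance Definition _ mu mu1 :=
  Measure_isProbability.Build _ _ _ (@unit_mass_probability mu mu1) mu1.

Lemma unit_mass_setC (mu : {measure set T -> \bar R}) (A : set T) :
  mu setT = 1 -> measurable A -> mu (~` A) = 1 - mu A.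
Proof. by move=> mu1 mA; exact: (probability_setC (unit_mass_probability mu1)). Qed.

Lemma unit_mass_fin_num (mu : {measure set T -> \bar R}) (A : set T) :
  mu setT = 1 -> measurable A -> mu A \is a fin_num.
Proof. by move=> mu1 mA; exact: (fin_num_measure (unit_mass_probability mu1)). Qed.

Lemma nonincreasing_mu_lt (mu : {measure set T -> \bar R}) (G : (set T)^nat)
    (e : R) : mu setT = 1 -> (forall n, measurable (G n)) ->
  nonincreasing_seq G -> \bigcap_n G n = set0 -> (0 < e)%R ->
  exists n, mu (G n) < e%:E.
Proof.
move=> mu1 mG niG G0 e0; apply: contrapT => /forallNP H.
have fin0 : mu (G 0%N) < +oo.
  by rewrite -ge0_fin_numE// unit_mass_fin_num.
have mcap : measurable (\bigcap_n G n) by rewrite G0.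
have cv := nonincreasing_cvg_mu fin0 mG mcap niG.
suff : e%:E <= mu (\bigcap_n G n).
  by rewrite G0 measure0 lee_fin leNgt e0.
rewrite -(cvg_lim _ cv)//; apply: lime_ge.
  by apply/cvg_ex; eexists; exact: cv.
by apply: nearW => n /=; rewrite leNgt; apply/negP; exact: H.
Qed.

(** Absolute continuity in its epsilon-delta form: [mu A] below some [dl] forces [nu A < e]. Once
    [mu A] reaches [dl], a factor [n.+1] above [1 / dl] makes the first term at least 1, hence at
    least [nu A]. *)
Lemma null_dominated_lt (nu mu : {measure set T -> \bar R}) (e : R) :
  nu setT = 1 ->
  (forall A, measurable A -> mu A = 0 -> nu A = 0) -> (0 < e)%R ->
  exists n : nat, forall A, measurable A -> nu A <= n.+1%:R%:E * mu A + e%:E.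
Proof.
move=> nu1 numu e0.
pose c := charge_of_finite_measure (unit_mass_probability nu1).
have [P [N PN]] := Hahn_decomposition c.
have cmu : c `<< mu by apply/null_content_dominatesP.
have [dl [dl0 dlP]] := charge_variation_continuous PN cmu e0.
have nue A : measurable A -> mu A < dl%:E -> nu A < e%:E.
  move=> mA muA; apply: le_lt_trans (dlP A mA muA).
  apply: le_trans (abse_charge_variation PN mA).
  by rewrite gee0_abs// /c/=.
pose n := Num.truncn dl^-1.
have ndl : (1 <= n.+1%:R * dl)%R.
  rewrite -ler_pdivrMr// mul1r ltW//; exact: Num.Theory.truncnS_gt.
exists n => A mA; have [muA|muA] := ltP (mu A) dl%:E.
  by rewrite (le_trans (ltW (nue _ mA muA)))// -[leLHS]add0e leeD2r// mule_ge0.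
apply: (@le_trans _ _ 1).
  by rewrite -nu1 le_measure ?inE.
rewrite -[leLHS]adde0 leeD ?lee_fin ?(ltW e0)//.
apply: (@le_trans _ _ (n.+1%:R%:E * dl%:E)); first by rewrite -EFinM lee_fin.
by rewrite lee_pmul2l.
Qed.

End unit_mass.

Section state_space_regularity.
Context {R : realType} {U : pseudoMetricType R} {A : set U} {A0 : A !=set0}.
Local Notation Z := (state_space A0).
Variables (mu : {measure set Z -> \bar R}) (mu1 : mu setT = 1).

(** The sets that can be so approximated for every [e] form a sigma-algebra, which contains the open
    sets because these are increasing unions of closed ones. *)
Lemma state_space_regularity (B : set Z) (e : R) : measurable B -> (0 < e)%R ->
  exists F O, [/\ closed F, open O, F `<=` B, B `<=` O & mu (O `\` F) < e%:E].
Proof.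
move=> mB.
pose C : set (set Z) := [set B | forall e : R, (0 < e)%R -> exists F O,
  [/\ closed F, open O, F `<=` B, B `<=` O & mu (O `\` F) < e%:E]].
suff BC : measurable `<=` C by exact: BC.
have mO := @state_space_open_measurable R U A A0.
have mF := @state_space_closed_measurable R U A A0.
apply: smallest_sub; last first.
  move=> O oO {}e e0; have [F [cF ndF OE]] := state_space_open_Fsigma oO.
  have [| | | |n mun] := @nonincreasing_mu_lt _ _ _ mu (fun n => O `\` F n) e mu1.
  - by move=> n; apply: measurableD; [exact: mO|exact: mF].
  - move=> n m nm; apply/subsetPset => z [Oz nFz].
    by split => // Fz; exact/nFz/(ndF _ _ nm).
  - apply/seteqP; split => // z Hz; have [Oz _] := Hz 0%N Logic.I.
    by move: Oz; rewrite OE => -[m _ Fmz]; have [] := Hz m Logic.I.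
  - exact: e0.
  exists (F n), O; split => //.
  by rewrite OE => z Fz; exists n.
split.
- by move=> {}e e0; exists set0, set0; rewrite set0D measure0; split => //;
    [exact: closed0|exact: open0].
- move=> B' CB' {}e e0; have [F [ O [cF oO FB BO muOF]]] := CB' e e0.
  exists (~` O), (~` F); split.
  + exact: open_closedC.
  + exact: closed_openC.
  + by rewrite setTD; exact: subsetC.
  + by rewrite setTD; exact: subsetC.
  + by rewrite [X in mu X](_ : _ = O `\` F)// setDE setCK setIC.
- move=> B' CB' {}e e0.
  have e20 : (0 < e / 2)%R by rewrite divr_gt0.
  (* One half of [e] is spread geometrically over the approximations of the single sets; the other
     half pays for cutting the union of the [F n], which may fail to be closed, down to a finite
     union. *)
  have en n : (0 < (e / 2) / (2 ^ n.+1)%:R)%R by rewrite divr_gt0// ltr0n expn_gt0.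
  have [F /choice[ O FO]] := choice (fun n => CB' n _ (en n)).
  have cF n : closed (F n) by case: (FO n).
  have oO n : open (O n) by case: (FO n).
  pose FN n := \bigcup_(i < n) F i.
  have cFN n : closed (FN n) by apply: closed_bigcup => //; exact: finite_II.
  have mOn n : measurable (O n) by exact: mO.
  have mFn n : measurable (F n) by exact: mF.
  have mFN n : measurable (FN n) by exact: mF.
  have mUF : measurable (\bigcup_n F n) by exact: bigcupT_measurable.
  have mUO : measurable (\bigcup_n O n) by exact: bigcupT_measurable.
  have [| | | |n mun] := @nonincreasing_mu_lt _ _ _ mu
      (fun n => \bigcup_n F n `\` FN n) (e / 2) mu1.
  + by move=> n; exact: measurableD.
  + move=> n m nm; apply/subsetPset => z [Fz nFz]; split => // -[i /= im Fi].
    by apply: nFz; exists i => //=; exact: leq_trans im nm.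
  + apply/seteqP; split => // z Hz; have [[m _ Fmz] _] := Hz 0%N Logic.I.
    by have [_ h] := Hz m.+1 Logic.I; exfalso; apply: h; exists m => /=.
  + exact: e20.
  exists (FN n), (\bigcup_n O n); split => //.
  + exact: bigcup_open.
  + by move=> z [i _ Fz]; exists i => //; case: (FO i) => _ _ + _ _; apply.
  + by move=> z [i _ Bz]; exists i => //; case: (FO i) => _ _ _ + _; apply.
  + have sub : \bigcup_n O n `\` FN n `<=`
        \bigcup_n (O n `\` F n) `|` (\bigcup_n F n `\` FN n).
      move=> z [[i _ Oz] nFz]; have [Fz|nF] := pselect ((\bigcup_n F n) z).
        by right.
      by left; exists i => //; split => // Fiz; apply: nF; exists i.
    have mOF i : measurable (O i `\` F i) by exact: measurableD.
    have mUOF : measurable (\bigcup_n (O n `\` F n)) by exact: bigcupT_measurable.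
    apply: (@le_lt_trans _ _ (mu (\bigcup_n (O n `\` F n)) +
        mu (\bigcup_n F n `\` FN n))).
      apply: le_trans (measureU2 _ _ _); [|exact: mUOF|exact: measurableD].
      by apply: le_measure => //; rewrite inE; [exact: measurableD|
        apply: measurableU => //; exact: measurableD].
    rewrite [ltRHS](_ : _ = (e / 2)%:E + (e / 2)%:E); last first.
      by rewrite -EFinD -splitr.
    have le1 : mu (\bigcup_n (O n `\` F n)) <= (e / 2)%:E.
      apply: (@le_trans _ _ (\sum_(0 <= i <oo) mu (O i `\` F i))).
        exact: measure_sigma_subadditive.
      apply: le_trans; last exact: (epsilon_trick0 xpredT (ltW e20)).
      by apply: lee_nneseries => // i _; apply: ltW; case: (FO i).
    by apply: lee_ltD => //; rewrite unit_mass_fin_num.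
Qed.

Lemma state_space_inner_regular (B : set Z) (e : R) : measurable B ->
  (0 < e)%R -> exists F, [/\ closed F, F `<=` B & mu B <= mu F + e%:E].
Proof.
move=> mB e0; have [F [ O [cF oO FB BO muOF]]] := state_space_regularity mB e0.
have mF := state_space_closed_measurable cF.
have mO := state_space_open_measurable oO.
exists F; split => //; rewrite -[X in mu X <= _](setDUK FB).
apply: le_trans (measureU2 _ mF (measurableD mB mF)) _.
rewrite leeD2l// (le_trans _ (ltW muOF))// le_measure ?inE//.
- exact: measurableD.
- exact: measurableD.
- exact: setSD.
Qed.

Definition measure_support : set Z := [set z | forall O, open O -> O z -> 0 < mu O].

Lemma measure_support_closed : closed measure_support.
Proof.
rewrite -[measure_support]setCK; apply: open_closedC.
rewrite openE => z /= /existsNP[ O] /not_implyP[oO] /not_implyP[Oz muO].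
rewrite /interior; apply: (@filterS _ _ _ O); last exact: open_nbhs_nbhs.
by move=> z' Oz' /(_ O oO Oz').
Qed.

(** The complement of the support is open, so it is a countable union of closed sets, whose
    intersections with the [K m] are compact. Each such piece is covered by finitely many null open
    sets. *)
Lemma measure_support_setC_null (K : nat -> set Z) : (forall n, compact (K n)) ->
  \bigcup_n K n = setT -> mu (~` measure_support) = 0.
Proof.
move=> cK KT.
have oS : open (~` measure_support) by exact/closed_openC/measure_support_closed.
have [F [cF _ SE]] := state_space_open_Fsigma oS.
have null n m : mu.-negligible (F n `&` K m).
  have cFK : compact (F n `&` K m).
    by rewrite setIC; apply: compact_closedI.
  have pO (z : Z) : exists O, (~` measure_support) z -> [/\ open O, O z & mu O = 0].
    have [Sz|nSz] := pselect ((~` measure_support) z); last by exists set0.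
    have := Sz => /existsNP[ O] /not_implyP[oO] /not_implyP[Oz muO].
    exists O => _; split => //; apply/eqP; rewrite eq_le measure_ge0 andbT.
    by rewrite leNgt; apply/negP.
  have [ O OP] := choice pO.
  have FS : F n `<=` ~` measure_support by rewrite SE => z Fz; exists n.
  move: cFK; rewrite compact_cover => /(_ Z (F n) O) [||D' D'F cov].
  - by move=> z /FS Sz; case: (OP z Sz).
  - by move=> z [Fz _]; exists z => //; case: (OP z (FS _ Fz)).
  - apply: (negligibleS cov); rewrite /cover bigcup_fset.
    rewrite big_seq; elim/big_ind : _ => //.
    + exact: negligible_set0.
    + exact: negligibleU.
    + move=> z zD'; have : F n z by have := D'F _ zD'; rewrite inE.
      move=> /FS /OP[oOz _ muO]; exists (O z); split => //.
      exact: state_space_open_measurable.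
apply/negligibleP; first exact: state_space_open_measurable.
rewrite SE; apply: negligible_bigcup => n.
rewrite -[F n]setIT -KT setI_bigcupr; exact: negligible_bigcup.
Qed.

End state_space_regularity.

(** * Small sets of Feller kernels *)

Lemma kernel_op_markov {d : measure_display} {Z : measurableType d}
  {R : realType} (P : R.-pker Z ~> Z) : markov_op (kernel_op P).
Proof.
split => [z|F [mF F0]]; first exact: (mean_integral (prob_kernel z)).
by apply: measurable_fun_integral_kernel => // B mB; exact: measurable_kernel.
Qed.

Lemma kernel_iterE {d : measure_display} {Z : measurableType d} {R : realType}
  (P : R.-pker Z ~> Z) n z (B : set Z) :
  kernel_iter P n z B = iter n (kernel_op P) (EFin \o \1_B) z.
Proof.
elim: n z => [|n ih] z /=; first by rewrite diracE indicE.
by rewrite /kernel_op; apply: eq_integral => z' _; exact: ih.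
Qed.

Lemma integral_ge_cst {d : measure_display} {Z : measurableType d}
    {R : realType} (mu : {measure set Z -> \bar R}) (F : Z -> \bar R)
    (B : set Z) (c : R) : nnmfun F -> measurable B -> (0 <= c)%R ->
  (forall z, B z -> c%:E <= F z) -> c%:E * mu B <= \int[mu]_z F z.
Proof.
move=> [mF F0] mB c0 cF; rewrite -integral_cst//.
apply: (@le_trans _ _ (\int[mu]_(z in B) F z)).
  by apply: ge0_le_integral => //; exact: measurable_funTS.
exact: ge0_subset_integral.
Qed.

Section feller_small.
Context {R : realType} {U : pseudoMetricType R} {A : set U} {A0 : A !=set0}.
Local Notation Z := (state_space A0).
Variables (P : R.-pker Z ~> Z) (K : nat -> set Z).
Hypotheses (lcZ : locally_compact [set: Z]) (fP : feller (fun z B => P z B)).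
Hypotheses (cK : forall n, compact (K n)) (KT : \bigcup_n K n = setT).
Hypothesis eqP0 : forall x y B, measurable B -> P x B = 0 -> P y B = 0.

Let nu := P point.
Let D n := [set x : Z | forall F, closed F ->
  nu F <= n.+1%:R%:E * P x F + (3^-1)%:E].

Let P1 z : P z setT = 1. Proof. exact: prob_kernel. Qed.

Let nu1 : nu setT = 1. Proof. exact: P1. Qed.

(* The constant 1/3 leaves room: for every [B], one of [B] and its complement has
   [nu]-measure at least 1/2, hence [P x]-measure at least [1/6 / n.+1] for all
   [x] in [D n]. *)
Let D_closed n : closed (D n).
Proof.
have -> : D n = \bigcap_(F in @closed Z) [set x : Z |
    nu F <= n.+1%:R%:E * P x F + (3^-1)%:E].
  by apply/seteqP; split => x H F cF; exact: H.
apply: closed_bigI => F cF.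
rewrite -[X in closed X]setCK; apply: open_closedC.
have mF := state_space_closed_measurable cF.
pose b := fine (nu F); have nuF : nu F = b%:E by rewrite /b fineK// unit_mass_fin_num.
(* Since [P x F] and [P x (~] F)[add up to 1, failure of the inequality means that the latter
   exceeds a constant; as]~[F] is open, this is an open condition on [x] by the Feller property. *)
rewrite (_ : ~` _ = [set x | P x (~` F) > (1 - (b - 3^-1) / n.+1%:R)%R%:E]).
  exact: ((lower_semicontinuousP _).1 (fP (closed_openC cF))).
apply/funext => x; apply/propext => /=; rewrite unit_mass_setC// nuF.
pose q := fine (P x F); have -> : P x F = q%:E by rewrite /q fineK// unit_mass_fin_num.
rewrite (_ : 1 - q%:E = (1 - q)%R%:E)// -EFinM -EFinD lte_fin lee_fin.
rewrite ltrD2l ltrN2 ltr_pdivlMr// ltrBrDr mulrC ltNge.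
by split => [/negP|/negP].
Qed.

Let D_cover : \bigcup_n D n = setT.
Proof.
apply/seteqP; split => // x _.
have [| |n nP] := @null_dominated_lt _ _ _ nu (P x) 3^-1 (P1 _).
- by move=> B mB; exact: eqP0.
- by [].
- by exists n => // F cF; apply: nP; exact: state_space_closed_measurable.
Qed.

(** [D n] tests closed sets only, which makes it closed; inner regularity of [nu] passes the bound
    on to measurable sets. *)
Let D_measurable n x B : D n x -> measurable B ->
  nu B <= n.+1%:R%:E * P x B + (3^-1)%:E.
Proof.
move=> Dx mB; apply/lee_addgt0Pr => e e0.
have [F [cF FB nuBF]] := state_space_inner_regular (P1 point) mB e0.
apply: le_trans nuBF _; rewrite leeD2r// (le_trans (Dx F cF))// leeD2r//.
by rewrite lee_wpmul2l// le_measure ?inE//; exact: state_space_closed_measurable.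
Qed.

(** One of [F], [G] is at least 1/2 on a set of [nu]-measure at least 1/2. From a point of [V] in
    the support, one step reaches that set with probability at least [1/6 / n.+1]; the step before
    it enters [V]. Which alternative holds does not depend on the starting point, so two starting
    points can be compared. *)
Lemma feller_small_open : exists (V : set Z) (al : R), [/\ open V, (0 < al)%R,
  forall x, 0 < P x V & forall F G : Z -> \bar R, nnmfun F -> nnmfun G ->
  (forall z, F z + G z = 1) ->
  (forall x, al%:E * P x V <= kernel_op P (kernel_op P F) x) \/
  (forall x, al%:E * P x V <= kernel_op P (kernel_op P G) x)].
Proof.
pose S := measure_support nu.
have cS : closed S := measure_support_closed (mu := nu).
have mS := state_space_closed_measurable cS.
have nuS : nu (~` S) = 0 := measure_support_setC_null nu cK KT.
have S0 : S !=set0.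
  apply/set0P/eqP => SE; move: nuS; rewrite SE setC0 nu1 => -[] /eqP.
  by rewrite oner_eq0.
have SD : S `<=` \bigcup_n D n by rewrite D_cover.
have [n [V [oV [z0 [Vz0 Sz0]]] VSD]] :=
  baire_locally_compact lcZ state_space_regular cS S0 D_closed SD.
have mV := state_space_open_measurable oV.
(* The complement of the support is null for [nu], hence for every law of the chain. *)
have PVS x : P x V = P x (V `&` S).
  rewrite (measureDI _ mV mS) [X in X + _](_ : _ = 0) ?add0e//.
  apply: (subset_measure0 (B := ~` S)) => //.
  - exact: measurableD.
  - exact: measurableC.
  - by apply: eqP0 nuS; exact: measurableC.
(* [V] is open and contains a point of the support, so it is not null for [nu], hence for no law of
   the chain. *)
have PV0 x : 0 < P x V.
  rewrite lt0e measure_ge0 andbT; apply/eqP => PxV.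
  have nuV : nu V = 0 by exact: eqP0 PxV.
  by have := Sz0 V oV Vz0; rewrite nuV ltxx.
have small (F : Z -> \bar R) (B : set Z) : nnmfun F -> measurable B ->
    (forall z, B z -> 2^-1%:E <= F z) -> 2^-1%:E <= nu B ->
    forall x, (12%:R^-1 / n.+1%:R)%:E * P x V <= kernel_op P (kernel_op P F) x.
  move=> nF mB BF nuB x; rewrite PVS; apply: integral_ge_cst.
  - exact: (markov_nnmfun (kernel_op_markov P)).
  - exact: measurableI.
  - by rewrite divr_ge0.
  move=> z /VSD Dz; apply: (@le_trans _ _ (2^-1%:E * P z B)); last first.
    exact: integral_ge_cst.
  have := le_trans nuB (D_measurable Dz mB).
  rewrite -[P z B]fineK ?unit_mass_fin_num//.
  by rewrite -!EFinM -EFinD !lee_fin ler_pdivrMr//; lra.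
exists V, (12%:R^-1 / n.+1%:R)%R; split => //.
move=> F G nF nG FG; pose B := [set z | 2^-1%:E <= F z].
have mB : measurable B.
  by rewrite -[B]setTI; apply: emeasurable_fun_c_infty => //; case: nF.
have nuBC : nu B + nu (~` B) = 1.
  by rewrite unit_mass_setC// addeC subeK// unit_mass_fin_num.
have [nuB|nuB] := leP 2^-1%:E (nu B).
  by left; apply: small nuB => //.
right; apply: (small _ (~` B)) => //; first exact: measurableC.
- move=> z /negP; rewrite -ltNge; have := FG z; case: nF => _ /(_ z).
  case: (F z) => [r||]//; case: (G z) => [s||]// _.
  by rewrite -EFinD => -[] ?; rewrite lte_fin lee_fin; lra.
- move: nuBC nuB; rewrite -[nu B]fineK ?unit_mass_fin_num//.
  rewrite -[nu (~` B)]fineK ?unit_mass_fin_num//; last exact: measurableC.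
  by rewrite -EFinD => -[] ?; rewrite lte_fin lee_fin; lra.
Qed.

End feller_small.

(** * Uniform lower bounds on compact sets *)

Section compact_lower_bound.
Context {R : realType}.

Lemma lower_semicontinuous_compact_ge {T : topologicalType} (f : T -> \bar R)
    (C : set T) : compact C -> lower_semicontinuous f ->
  (forall z, C z -> 0 < f z) ->
  exists2 dl : R, (0 < dl)%R & forall z, C z -> dl%:E <= f z.
Proof.
move=> cC /lower_semicontinuousP lscf f0.
have [| |n CW] := @compact_nondecreasing_cover _ C
    (fun n => [set z | f z > n.+1%:R^-1%:E]) cC (fun n => lscf _).
- move=> n m nm z /= zn; apply: le_lt_trans zn.
  by rewrite lee_fin lef_pV2 ?posrE// ler_nat.
- move=> z /f0; case fz : (f z) => [r| |]//; last first.
    by move=> _; exists 0%N => //=; rewrite fz ltry.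
  rewrite lte_fin => r0; exists (Num.truncn r^-1) => //=.
  rewrite fz lte_fin -[ltRHS]invrK ltf_pV2 ?posrE ?invr_gt0//.
  exact: Num.Theory.truncnS_gt.
- by exists n.+1%:R^-1%R => // z /CW /ltW.
Qed.

(** The open sets [O n] where [h] exceeds [1 / n.+1] increase to the whole space, so each [y] has an
    [n] with [Q y (O n) > 1/2]. This condition is open in [y], so by compactness one [n] serves all
    of [C]. *)
Lemma feller_compact_ge {T : topologicalType} {U : pseudoMetricType R}
    {A : set U} {A0 : A !=set0} (Q : T -> {measure set (state_space A0) -> \bar R})
    (h : state_space A0 -> \bar R) (C : set T) :
  (forall y, Q y setT = 1) ->
  (forall O, open O -> lower_semicontinuous (fun y => Q y O)) ->
  nnmfun h -> lower_semicontinuous h -> (forall z, 0 < h z) -> compact C ->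
  exists2 dl : R, (0 < dl)%R & forall y, C y -> dl%:E <= \int[Q y]_z h z.
Proof.
move=> Q1 fQ nh /lower_semicontinuousP lsch h0 cC.
pose O n := [set z | h z > n.+1%:R^-1%:E].
have oO n : open (O n) by exact: lsch.
have mO n : measurable (O n) by exact: state_space_open_measurable.
have Ond n m : (n <= m)%N -> O n `<=` O m.
  move=> nm z /= zn; apply: le_lt_trans zn.
  by rewrite lee_fin lef_pV2 ?posrE// ler_nat.
have [| | |n CW] := @compact_nondecreasing_cover _ C
    (fun n => [set y | Q y (O n) > 2^-1%:E]) cC _.
- by move=> n; exact: ((lower_semicontinuousP _).1 (fQ _ (oO n))).
- by move=> n m nm y /= yn; rewrite (lt_le_trans yn)// le_measure ?inE//; exact: Ond.
- move=> y _.
  have [| | | |n Qn] := @nonincreasing_mu_lt _ _ _ (Q y) (fun n => ~` O n) 2^-1 (Q1 y).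
  + by move=> n; exact: measurableC.
  + by move=> n m nm; apply/subsetPset; apply: subsetC; exact: Ond.
  + apply/seteqP; split => // z Hz; have := h0 z.
    have : forall n, ~ O n z by move=> n; exact: Hz.
    rewrite /O /=; case: (h z) => [r| |]//; last by move=> /(_ 0%N); rewrite ltry.
    move=> /(_ (Num.truncn r^-1)) + r0; apply; move: r0; rewrite !lte_fin => r0.
    rewrite -[ltRHS]invrK ltf_pV2 ?posrE ?invr_gt0//.
    exact: Num.Theory.truncnS_gt.
  + by [].
  exists n => //=; move: Qn; rewrite unit_mass_setC//.
  rewrite -[Q y (O n)]fineK ?unit_mass_fin_num//.
  by rewrite (_ : 1 - _%:E = (1 - fine (Q y (O n)))%R%:E)// !lte_fin; lra.
- exists (n.+1%:R^-1 * 2^-1)%R => [|y /CW /= Qy]; first by rewrite mulr_gt0.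
  apply: (@le_trans _ _ (n.+1%:R^-1%:E * Q y (O n))).
    by rewrite EFinM lee_wpmul2l// ltW.
  by apply: integral_ge_cst => // z /ltW.
Qed.

End compact_lower_bound.

(** * Total variation bounds and integrability of drift functions *)

Section ergodicity.
Context {d : measure_display} {Z : measurableType d} {R : realType}.

Lemma tv_norm_le (nu : set Z -> \bar R) (b : R) :
  (forall B, measurable B -> (- b)%:E <= nu B <= b%:E) ->
  tv_norm nu <= (2 * b)%:E.
Proof.
move=> nub; rewrite (_ : 2 * b = b - - b)%R; last by rewrite opprK mulr2n mulrDl mul1r.
rewrite EFinB; apply: leeB.
- by apply: ge_ereal_sup => _ [B mB <-]; case/andP: (nub B mB).
- by apply: le_ereal_inf_tmp => _ [B mB <-]; case/andP: (nub B mB).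
Qed.

Lemma geometrically_ergodicP (P : R.-pker Z ~> Z) (w : {measure set Z -> \bar R})
    (M : Z -> R) (t : R) : w setT = 1 -> (0 < t < 1)%R ->
  (forall B n z, measurable B ->
    kernel_iter P n z B <= w B + (M z * t ^+ n)%:E /\
    w B <= kernel_iter P n z B + (M z * t ^+ n)%:E) ->
  geometrically_ergodic P w.
Proof.
(* The factor 2 appears because [tv_norm] is a supremum minus an infimum, each bounded by the
   setwise error. *)
move=> w1 t01 H; exists (fun z => 2 * M z)%R, t; split => // z n.
rewrite -mulrA; apply: tv_norm_le => B mB /=.
have [] := H B n z mB.
have wB : w B \is a fin_num by rewrite unit_mass_fin_num.
have kB : kernel_iter P n z B \is a fin_num.
  rewrite kernel_iterE; have [mn _] := markov_op_iter n (kernel_op_markov P).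
  apply: (mean_fin_num (mn z)); first exact: nnmfun_indic.
  by move=> z' /=; rewrite lee_fin indicE; case: (z' \in B).
rewrite -(fineK wB) -(fineK kB) -!EFinD !lee_fin => h1 h2.
by apply/andP; split; lra.
Qed.

(** The mean of [V] might be infinite, so it cannot be cancelled directly. Invariance applied to
    [min(V, n)] bounds its mean by that of [min(lam V + L, n)]. Both are finite, and comparing them
    bounds the integral of [V] over its sublevel set at [n] by [L / (1 - lam)]; monotone convergence
    concludes. *)
Lemma stationary_drift_lty (P : R.-pker Z ~> Z) (w : {measure set Z -> \bar R})
    (V : Z -> R) (lam L : R) : w setT = 1 ->
  (forall F, nnmfun F -> \int[w]_z kernel_op P F z = \int[w]_z F z) ->
  measurable_fun setT V -> (forall z, 0 <= V z)%R -> (0 <= lam < 1)%R ->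
  (0 <= L)%R -> (forall z, kernel_op P (EFin \o V) z <= (lam * V z + L)%:E) ->
  \int[w]_z (V z)%:E < +oo.
Proof.
move=> w1 wP mV V0 /andP[lam0 lam1] L0 PV.
have mw := mean_integral w1; have mP := kernel_op_markov P.
have [mPz _] := mP.
have nV := nnmfun_EFin mV V0.
pose trunc (n : nat) := (fun z => V z * \1_[set z | (V z <= n%:R)%R] z)%R.
have mVn n : measurable [set z | (V z <= n%:R)%R].
  by rewrite -[X in measurable X]setTI; exact: measurable_fun_le.
have mt n : measurable_fun setT (trunc n) by apply: measurable_funM.
have t0 n z : (0 <= trunc n z)%R by rewrite mulr_ge0// indicE.
have bound n : \int[w]_z (trunc n z)%:E <= (L / (1 - lam))%:E.
  pose f z := Num.min (V z) n%:R; pose g z := Num.min (lam * V z + L)%R n%:R.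
  have mf : measurable_fun setT f by exact: measurable_minr.
  have mg : measurable_fun setT g.
    apply: measurable_minr => //; apply: measurable_funD => //.
    exact: measurable_funM.
  have f0 z : (0 <= f z)%R by rewrite le_min V0/=.
  have g0 z : (0 <= g z)%R by rewrite le_min addr_ge0 ?mulr_ge0/=.
  have nf := nnmfun_EFin mf f0; have ng := nnmfun_EFin mg g0.
  have nt := nnmfun_EFin (mt n) (t0 n).
  have le1 : \int[w]_z (EFin \o f) z <= \int[w]_z (EFin \o g) z.
    rewrite -wP//; apply: (le_mean mw) => //; first exact: markov_nnmfun.
    move=> z; rewrite /= EFin_min le_min; apply/andP; split.
      apply: le_trans (PV z); apply: (le_mean (mPz z)) => // z'.
      by rewrite lee_fin ge_min lexx.
    rewrite -(mean_cst (mPz z) (ler0n R n)).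
    apply: (le_mean (mPz z)) => //; first exact: nnmfun_cst.
    by move=> z'; rewrite lee_fin ge_min lexx orbT.
  (* Pointwise, [(1 - lam) V 1_(V <= n) + min(lam V + L, n) <= min(V, n) + L]. *)
  have le2 : (1 - lam)%:E * \int[w]_z (EFin \o trunc n) z +
      \int[w]_z (EFin \o g) z <= L%:E + 1%:E * \int[w]_z (EFin \o f) z.
    have l0 : (0 <= 1 - lam)%R by rewrite subr_ge0 ltW.
    rewrite -(mean_affine mw)// -(meanZ mw)// -(meanD mw)//; last exact: nnmfunZ.
    apply: (le_mean mw).
    - by apply: nnmfunD => //; exact: nnmfunZ.
    - apply: (@nnmfun_EFin _ _ _ (fun z => L + 1 * f z)%R) => [|z].
      + by apply: measurable_funD => //; exact: measurable_funM.
      + by rewrite addr_ge0// mul1r.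
    move=> z; rewrite /= -EFinM -EFinD lee_fin /f /g /trunc indicE.
    have [Vn|Vn] := boolP (V z <= n%:R)%R.
      rewrite mem_set//= mulr1 (min_idPl Vn) mul1r.
      have : (Num.min (lam * V z + L)%R n%:R <= lam * V z + L)%R by rewrite ge_min lexx.
      by lra.
    rewrite memNset/=; last exact/negP.
    have : (Num.min (lam * V z + L)%R n%:R <= n%:R)%R by rewrite ge_min lexx orbT.
    have /ltW/min_idPr -> : (n%:R < V z)%R by rewrite ltNge.
    by lra.
  have gfin : \int[w]_z (EFin \o g) z \is a fin_num.
    rewrite ge0_fin_numE ?(mean_ge0 mw)//.
    apply: (@le_lt_trans _ _ n%:R%:E); last by rewrite ltry.
    rewrite -(mean_cst mw (ler0n R n)); apply: (le_mean mw) => //.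
      exact: nnmfun_cst.
    by move=> z; rewrite lee_fin ge_min lexx orbT.
  have le3 : (1 - lam)%:E * \int[w]_z (EFin \o trunc n) z <= L%:E.
    rewrite -(leeD2rE _ _ gfin); apply: le_trans le2 _.
    by rewrite mul1e leeD2l.
  by rewrite mulrC EFinM lee_pdivlMl// subr_gt0.
pose F (n : nat) := [set z | (V z <= n%:R)%R].
have Fnd : nondecreasing_seq F.
  move=> n m nm; apply/subsetPset => z /= zn; apply: le_trans zn _.
  by rewrite ler_nat.
have FT : \bigcup_n F n = setT.
  apply/seteqP; split => // z _; exists (Num.truncn (V z)).+1 => //.
  by rewrite /F/= ltW// Num.Theory.truncnS_gt.
have cvgF : \int[w]_(z in F n) (V z)%:E @[n --> \oo] --> \int[w]_z (V z)%:E.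
  rewrite -FT; apply: ge0_nondecreasing_set_cvg_integral => // n.
  - by apply: measurable_funTS; exact/measurable_EFinP.
  - by move=> z _; rewrite lee_fin.
apply: (@le_lt_trans _ _ (L / (1 - lam))%:E); last by rewrite ltry.
rewrite -(cvg_lim _ cvgF)//; apply: lime_le.
  by apply/cvg_ex; eexists; exact: cvgF.
apply: nearW => n; apply: le_trans (bound n).
rewrite integral_mkcond le_eqVlt; apply/orP; left; apply/eqP/eq_integral => z _.
rewrite patchE /trunc indicE -/(F n).
by case: ifPn => zF; rewrite ?mulr1 ?mulr0.
Qed.

End ergodicity.

(** * The conditional laws and the Gibbs kernels *)

Section integral_density.
Context {d : measure_display} {T : measurableType d} {R : realType}.
Variables (mu nu : {measure set T -> \bar R}) (h : T -> R).
Hypotheses (mh : measurable_fun setT h) (h0 : forall x, (0 <= h x)%R).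
Hypothesis nuE : forall A, measurable A -> nu A = \int[mu]_(x in A) (h x)%:E.

Let integral_density_indic A : measurable A ->
  \int[nu]_x (\1_A x)%:E = \int[mu]_x ((\1_A x)%:E * (h x)%:E).
Proof.
move=> mA; rewrite integral_indic// setIT nuE// integral_mkcond.
apply: eq_integral => x _; rewrite patchE indicE.
by case: ifPn => _; rewrite ?mul1e ?mul0e.
Qed.

Import HBNNSimple.

Let integral_density_nnsfun (f : {nnsfun T >-> R}) :
  \int[nu]_x (f x)%:E = \int[mu]_x ((f x)%:E * (h x)%:E).
Proof.
under [LHS]eq_integral do rewrite fimfunE -fsumEFin//.
rewrite [LHS]ge0_integral_fsum//; last 2 first.
  - by move=> r; exact/measurable_EFinP/measurableT_comp.
  - by move=> n x _; rewrite EFinM nnfun_muleindic_ge0.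
under [RHS]eq_integral.
  move=> x xD; rewrite fimfunE -fsumEFin// muleC ge0_mule_fsumr; last first.
    by move=> r; rewrite EFinM nnfun_muleindic_ge0.
  over.
rewrite [RHS]ge0_integral_fsum//; last 2 first.
  - move=> r; apply: emeasurable_funM; first exact/measurable_EFinP.
    exact/measurable_EFinP/measurableT_comp.
  - move=> n x _; rewrite mule_ge0 ?lee_fin// -lee_fin EFinM.
    by rewrite nnfun_muleindic_ge0.
apply: eq_fsbigr => r _; have [r0|r0] := leP 0%R r; last first.
  rewrite !integral0_eq// => x _.
    by rewrite preimage_nnfun0// indic0 mulr0 mule0.
  by rewrite preimage_nnfun0// indic0 mulr0.
rewrite integralZl_indic_nnsfun//= integral_density_indic//.
rewrite -ge0_integralZl//; last 2 first.
- apply: emeasurable_funM; exact/measurable_EFinP.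
- by move=> x _; rewrite mule_ge0// lee_fin// indicE.
by apply: eq_integral => x _; rewrite EFinM [LHS]muleA [RHS]muleC.
Qed.

(** [nuE] speaks of sets; the formula passes from indicators to simple functions and then to
    monotone limits. *)
Lemma integral_density (f : T -> \bar R) : nnmfun f ->
  \int[nu]_x f x = \int[mu]_x (f x * (h x)%:E).
Proof.
move=> [mf f0]; pose f_ := nnsfun_approx measurableT mf.
have f_cvg x : (f_ n x)%:E @[n --> \oo] --> f x.
  by apply: cvg_nnsfun_approx => // y _; exact: f0.
transitivity (lim (\int[nu]_x (f_ n x)%:E @[n --> \oo])).
  rewrite -monotone_convergence//=.
  - by apply: eq_integral => x _; apply/esym/cvg_lim => //; exact: f_cvg.
  - by move=> n; exact/measurable_EFinP.
  - by move=> n x _; rewrite lee_fin.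
  - by move=> x _ a b ab; rewrite lee_fin; exact/lefP/nd_nnsfun_approx.
under eq_fun do rewrite integral_density_nnsfun.
rewrite -monotone_convergence//=.
- apply: eq_integral => x _; apply/cvg_lim => //.
  by apply: cvgeZr => //; exact: f_cvg.
- by move=> n; apply: emeasurable_funM; exact/measurable_EFinP.
- by move=> n x _; rewrite mule_ge0// lee_fin.
- move=> x _ a b ab; rewrite lee_wpmul2r ?lee_fin//.
  exact/lefP/nd_nnsfun_approx.
Qed.

End integral_density.

Section gibbs_kernels.
Context {d1 d2 : measure_display} {X : measurableType d1} {Y : measurableType d2}
  {R : realType}.
Variables (muX : {sigma_finite_measure set X -> \bar R})
  (muY : {sigma_finite_measure set Y -> \bar R})
  (varpi : probability (X * Y)%type R) (pi : joint_density muX muY varpi).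

Definition cond_lawX (y : Y) (A : set X) : \bar R :=
  \int[muX]_(x in A) (condX pi x y)%:E.
Definition cond_lawY (x : X) (A : set Y) : \bar R :=
  \int[muY]_(y in A) (condY pi y x)%:E.

Let measurable_condX1 y : measurable_fun setT (condX pi ^~ y).
Proof. exact: (measurableT_comp (measurable_condX pi) (pair2_measurable y)). Qed.

Let measurable_condY1 x : measurable_fun setT (condY pi ^~ x).
Proof. exact: (measurableT_comp (measurable_condY pi) (pair1_measurable x)). Qed.

Let cond_lawX0 y : cond_lawX y set0 = 0. Proof. exact: integral_set0. Qed.
Let cond_lawX_ge0 y A : 0 <= cond_lawX y A.
Proof. by apply: integral_ge0 => x _; rewrite lee_fin condX_ge0. Qed.
Let cond_lawX_sigma_additive y : semi_sigma_additive (cond_lawX y).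
Proof.
apply: integral_ge0_sigma_additive => [|x]; last by rewrite lee_fin condX_ge0.
exact/measurable_EFinP.
Qed.

HB.instance Definition _ y := isMeasure.Build _ _ _ (cond_lawX y)
  (cond_lawX0 y) (@cond_lawX_ge0 y) (@cond_lawX_sigma_additive y).

Definition QX : Y -> {measure set X -> \bar R} := cond_lawX.

Let measurable_QX A : measurable A -> measurable_fun setT (QX ^~ A).
Proof.
move=> mA; apply: (measurable_fun_integral_in muX
    (f := fun w : Y * X => (condX pi w.2 w.1)%:E)) => //.
- apply/measurable_EFinP.
  exact: (measurableT_comp (measurable_condX pi) (@measurable_swap _ _ _ _)).
- by move=> w; rewrite lee_fin condX_ge0.
Qed.

HB.instance Definition _ := isKernel.Build _ _ Y X R QX measurable_QX.

Let QX_setT y : QX y setT = 1. Proof. exact: integral_condX. Qed.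

HB.instance Definition _ := Kernel_isProbability.Build _ _ Y X R QX QX_setT.

Let cond_lawY0 x : cond_lawY x set0 = 0. Proof. exact: integral_set0. Qed.
Let cond_lawY_ge0 x A : 0 <= cond_lawY x A.
Proof. by apply: integral_ge0 => y _; rewrite lee_fin condY_ge0. Qed.
Let cond_lawY_sigma_additive x : semi_sigma_additive (cond_lawY x).
Proof.
apply: integral_ge0_sigma_additive => [|y]; last by rewrite lee_fin condY_ge0.
exact/measurable_EFinP.
Qed.

HB.instance Definition _ x := isMeasure.Build _ _ _ (cond_lawY x)
  (cond_lawY0 x) (@cond_lawY_ge0 x) (@cond_lawY_sigma_additive x).

Definition QY : X -> {measure set Y -> \bar R} := cond_lawY.

Let measurable_QY A : measurable A -> measurable_fun setT (QY ^~ A).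
Proof.
move=> mA; apply: (measurable_fun_integral_in muY
    (f := fun w : X * Y => (condY pi w.2 w.1)%:E)) => //.
- by apply/measurable_EFinP; exact: measurable_condY.
- by move=> w; rewrite lee_fin condY_ge0.
Qed.

HB.instance Definition _ := isKernel.Build _ _ X Y R QY measurable_QY.

Let QY_setT x : QY x setT = 1. Proof. exact: integral_condY. Qed.

HB.instance Definition _ := Kernel_isProbability.Build _ _ X Y R QY QY_setT.

Lemma integral_QX (F : X -> \bar R) y : nnmfun F ->
  \int[QX y]_x F x = \int[muX]_x (F x * (condX pi x y)%:E).
Proof.
by move=> nF; apply: integral_density => // x; exact: condX_ge0.
Qed.

Lemma integral_QY (F : Y -> \bar R) x : nnmfun F ->
  \int[QY x]_y F y = \int[muY]_y (F y * (condY pi y x)%:E).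
Proof.
by move=> nF; apply: integral_density => // y; exact: condY_ge0.
Qed.

End gibbs_kernels.

(** * The Gibbs kernels as successive conditional draws *)

Section gibbs_operators.
Context {d1 d2 : measure_display} {X : measurableType d1} {Y : measurableType d2}
  {R : realType}.
Variables (muX : {sigma_finite_measure set X -> \bar R})
  (muY : {sigma_finite_measure set Y -> \bar R})
  (varpi : probability (X * Y)%type R) (pi : joint_density muX muY varpi).

Lemma nnmfun_pair1 (F : X * Y -> \bar R) x : nnmfun F -> nnmfun (fun y => F (x, y)).
Proof.
by move=> [mF F0]; split => //; exact: (measurableT_comp mF (pair1_measurable x)).
Qed.

Lemma nnmfun_pair2 (F : X * Y -> \bar R) y : nnmfun F -> nnmfun (fun x => F (x, y)).
Proof.
by move=> [mF F0]; split => //; exact: (measurableT_comp mF (pair2_measurable y)).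
Qed.

Lemma nnmfun_fst (F : X -> \bar R) : nnmfun F -> nnmfun (fun z : X * Y => F z.1).
Proof. by move=> [mF F0]; split => //; exact: measurableT_comp. Qed.

Lemma nnmfun_snd (F : Y -> \bar R) : nnmfun F -> nnmfun (fun z : X * Y => F z.2).
Proof. by move=> [mF F0]; split => //; exact: measurableT_comp. Qed.

Lemma nnmfun_integral_QX (F : X * Y -> \bar R) : nnmfun F ->
  nnmfun (fun y => \int[QX pi y]_x F (x, y)).
Proof.
move=> [mF F0]; split => [|y]; last exact: integral_ge0.
apply: (measurable_kfcomp (QX pi) (f := fun w : Y * X => F (w.2, w.1))) => //.
exact: (measurableT_comp mF (@measurable_swap _ _ _ _)).
Qed.

Lemma nnmfun_integral_QY (F : X * Y -> \bar R) : nnmfun F ->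
  nnmfun (fun x => \int[QY pi x]_y F (x, y)).
Proof.
move=> [mF F0]; split => [|x]; last exact: integral_ge0.
exact: (measurable_kfcomp (QY pi) (f := F)).
Qed.

Lemma measurable_condX1 y : measurable_fun setT (condX pi ^~ y).
Proof. exact: (measurableT_comp (measurable_condX pi) (pair2_measurable y)). Qed.

Lemma measurable_condY1 x : measurable_fun setT (condY pi ^~ x).
Proof. exact: (measurableT_comp (measurable_condY pi) (pair1_measurable x)). Qed.

(** The transition density integrates [y] out for fixed end point; by Tonelli the step is a draw of
    [y] given [x] followed by a draw of [x'] given [y]. *)
Lemma kernel_op_P_X (F : X -> \bar R) x : nnmfun F ->
  kernel_op (P_X pi) F x = \int[QY pi x]_y \int[QX pi y]_x' F x'.
Proof.
move=> [mF F0]; rewrite /kernel_op.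
transitivity (\int[kcomp (QY pi) (kernel.kernel_snd (QX pi)) x]_x' F x').
  apply: eq_measure_integral => A mA _.
  transitivity (\int[QY pi x]_y QX pi y A); last by [].
  rewrite integral_QY; last first.
    by split => [|y]; [exact: measurable_kernel|exact: measure_ge0].
  pose f (w : X * Y) : \bar R :=
    (\1_A w.1 * (condX pi w.1 w.2 * condY pi w.2 x))%:E.
  have mcY : measurable_fun setT (fun w : X * Y => condY pi w.2 x).
    exact: (measurableT_comp (measurable_condY1 x)).
  have mf : measurable_fun setT f.
    apply/measurable_EFinP; apply: measurable_funM.
      by apply: (measurableT_comp (measurable_indic mA)).
    by apply: measurable_funM => //; exact: measurable_condX.
  have f0 w : 0 <= f w.
    by rewrite /f lee_fin; apply: mulr_ge0 => //;
      rewrite mulr_ge0 ?condX_ge0 ?condY_ge0.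
  transitivity (\int[muX]_x' \int[muY]_y f (x', y)).
    rewrite /P_X /= /marginal_chain /marginal_density integral_mkcond.
    apply: eq_integral => x' _; rewrite patchE; case: ifPn => x'A.
      by apply: eq_integral => y _; rewrite /f indicE/= x'A mul1r.
    by rewrite integral0_eq// => y _; rewrite /f indicE/= (negbTE x'A) mul0r.
  rewrite (@fubini_tonelli _ _ _ _ _ muX muY f)//; apply: eq_integral => y _.
  rewrite /fubini_G /QX /= /cond_lawX -ge0_integralZr//.
  - rewrite [RHS]integral_mkcond; apply: eq_integral => x' _.
    rewrite patchE /f indicE /=.
    by case: ifPn => _; rewrite ?mul1r ?mul0r// EFinM.
  - by apply: measurable_funTS; exact/measurable_EFinP/measurable_condX1.
  - by move=> x' _; rewrite lee_fin condX_ge0.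
  - by rewrite lee_fin condY_ge0.
by rewrite integral_kcomp.
Qed.

Lemma kernel_op_P_DGS (F : X * Y -> \bar R) z : nnmfun F ->
  kernel_op (P_DGS pi) F z = \int[QX pi z.2]_x \int[QY pi x]_y F (x, y).
Proof.
move=> nF; rewrite /kernel_op.
have mg : measurable_fun setT (fun w : X * Y => condX pi w.1 z.2 * condY pi w.2 w.1)%R.
  apply: measurable_funM; last exact: measurable_condY.
  exact: (measurableT_comp (measurable_condX1 z.2)).
have g0 (w : X * Y) : (0 <= condX pi w.1 z.2 * condY pi w.2 w.1)%R.
  by rewrite mulr_ge0 ?condX_ge0 ?condY_ge0.
rewrite (integral_density (mu := muX \x muY) mg g0)// fubini_tonelli1; last 2 first.
- apply: emeasurable_funM; first by case: nF.
  exact/measurable_EFinP.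
- by move=> w; rewrite mule_ge0 ?lee_fin//; case: nF.
rewrite integral_QX; last exact: nnmfun_integral_QY.
apply: eq_integral => x _; rewrite /fubini_F/= integral_QY; last exact: nnmfun_pair1.
rewrite -ge0_integralZr//.
- by apply: eq_integral => y _; rewrite EFinM [(condX _ _ _)%:E * _]muleC muleA.
- apply: emeasurable_funM; first by case: (nnmfun_pair1 x nF).
  exact/measurable_EFinP/measurable_condY1.
- by move=> y _; rewrite mule_ge0 ?lee_fin ?condY_ge0//; case: nF.
- by rewrite lee_fin condX_ge0.
Qed.

Lemma kernel_op_P_RGS p (p01 : (0 < p < 1)%R) (F : X * Y -> \bar R) z :
  nnmfun F -> kernel_op (P_RGS pi p01) F z =
  p%:E * \int[QX pi z.2]_x F (x, z.2) + (1 - p)%:E * \int[QY pi z.1]_y F (z.1, y).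
Proof.
move=> [mF F0]; rewrite /kernel_op; have [p0 p1] := andP p01.
have p_ge0 : (0 <= p)%R by exact: ltW.
have q_ge0 : (0 <= 1 - p)%R by rewrite subr_ge0 ltW.
have m1 : measurable_fun setT (fun x : X => (x, z.2)) by exact: pair2_measurable.
have m2 : measurable_fun setT (fun y : Y => (z.1, y)) by exact: pair1_measurable.
pose i1 := isMeasurableFun.Build _ _ _ _ _ m1.
pose i2 := isMeasurableFun.Build _ _ _ _ _ m2.
pose f1 : {mfun X >-> (X * Y)%type} := HB.pack (fun x : X => (x, z.2)) i1.
pose f2 : {mfun Y >-> (X * Y)%type} := HB.pack (fun y : Y => (z.1, y)) i2.
pose PX := unit_mass_probability (integral_condX pi z.2 : QX pi z.2 setT = 1).
pose PY := unit_mass_probability (integral_condY pi z.1 : QY pi z.1 setT = 1).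
(* One step from [z] is a mixture of two image measures, along the two coordinate lines through
   [z]. *)
transitivity (\int[measure_add
   (mscale (NngNum p_ge0) (distribution PX f1))
   (mscale (NngNum q_ge0) (distribution PY f2))]_w F w).
  apply: eq_measure_integral => A mA _.
  rewrite [RHS]measure_addE /P_RGS /= /random_scan; congr (_ * _ + _ * _).
  - transitivity (\int[muX]_(x in (fun x => (x, z.2)) @^-1` A) (condX pi x z.2)%:E);
      last by [].
    rewrite [RHS]integral_mkcond; apply: eq_integral => x _; rewrite patchE indicE.
    have [Ax|Ax] := boolP ((x, z.2) \in A).
      by rewrite mem_set ?mul1r//; move: Ax; rewrite inE.
    by rewrite memNset ?mul0r//; move: Ax; rewrite notin_setE.
  - transitivity (\int[muY]_(y in (fun y => (z.1, y)) @^-1` A) (condY pi y z.1)%:E);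
      last by [].
    rewrite [RHS]integral_mkcond; apply: eq_integral => y _; rewrite patchE indicE.
    have [Ay|Ay] := boolP ((z.1, y) \in A).
      by rewrite mem_set ?mul1r//; move: Ay; rewrite inE.
    by rewrite memNset ?mul0r//; move: Ay; rewrite notin_setE.
rewrite ge0_integral_measure_add// !ge0_integral_mscale//.
by rewrite !ge0_integral_distribution.
Qed.

Lemma integral_varpi (F : X * Y -> \bar R) : nnmfun F ->
  \int[varpi]_z F z = \int[muX]_x \int[muY]_y (F (x, y) * (pi (x, y))%:E).
Proof.
move=> [mF F0].
rewrite (integral_density (mu := muX \x muY) (measurable_density pi)
  (density_ge0 pi) (densityE pi))// fubini_tonelli1//.
- apply: emeasurable_funM => //; apply/measurable_EFinP; exact: measurable_density.
- by move=> w; rewrite mule_ge0 ?lee_fin// density_ge0.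
Qed.

Let mpi : measurable_fun setT (EFin \o pi).
Proof. by apply/measurable_EFinP; exact: measurable_density. Qed.

Let marginXE x : \int[muY]_y (pi (x, y))%:E = (marginX pi x)%:E.
Proof.
by rewrite fineK//; apply: integrable_fin_num => //; exact: density_integrableX.
Qed.

Let marginYE y : \int[muX]_x (pi (x, y))%:E = (marginY pi y)%:E.
Proof.
by rewrite fineK//; apply: integrable_fin_num => //; exact: density_integrableY.
Qed.

(** Redrawing [y] given [x] preserves [varpi] because [condY] times the marginal density of [x] is
    again the joint density. *)
Lemma stationary_QY (F : X * Y -> \bar R) : nnmfun F ->
  \int[varpi]_z \int[QY pi z.1]_y F (z.1, y) = \int[varpi]_z F z.
Proof.
move=> nF; have nQ := nnmfun_integral_QY nF.
rewrite (integral_varpi (nnmfun_fst nQ)) (integral_varpi nF).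
apply: eq_integral => x _ /=.
rewrite ge0_integralZl//; last 3 first.
- exact: (measurableT_comp mpi (pair1_measurable x)).
- by move=> y _; rewrite lee_fin density_ge0.
- by have [_] := nQ; apply.
have nFx := nnmfun_pair1 x nF.
rewrite marginXE integral_QY// -ge0_integralZr//; last 3 first.
- apply: emeasurable_funM; first by case: nFx.
  exact/measurable_EFinP/measurable_condY1.
- by move=> y _; rewrite mule_ge0 ?lee_fin ?condY_ge0//; case: nFx.
- by rewrite lee_fin ltW// density_marginX_gt0.
apply: eq_integral => y _; rewrite -muleA -EFinM /condY divfK//.
by rewrite gt_eqF// density_marginX_gt0.
Qed.

Lemma stationary_QX (F : X * Y -> \bar R) : nnmfun F ->
  \int[varpi]_z \int[QX pi z.2]_x F (x, z.2) = \int[varpi]_z F z.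
Proof.
move=> nF; have nQ := nnmfun_integral_QX nF.
have mFpi G : nnmfun G -> measurable_fun setT (fun w => G w * (pi w)%:E).
  by move=> [mG _]; exact: emeasurable_funM.
have Fpi0 G : nnmfun G -> forall w, 0 <= G w * (pi w)%:E.
  by move=> [_ G0] w; rewrite mule_ge0 ?lee_fin// density_ge0.
rewrite (integral_varpi (nnmfun_snd nQ)) (integral_varpi nF).
(* The integral over [x] must be innermost before the marginal density of [y] can appear. *)
rewrite (@fubini_tonelli _ _ _ _ _ muX muY _ (mFpi _ (nnmfun_snd nQ))
  (Fpi0 _ (nnmfun_snd nQ))).
rewrite [RHS](@fubini_tonelli _ _ _ _ _ muX muY _ (mFpi _ nF) (Fpi0 _ nF)).
apply: eq_integral => y _; rewrite /fubini_G /=.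
rewrite ge0_integralZl//; last 3 first.
- exact: (measurableT_comp mpi (pair2_measurable y)).
- by move=> x _; rewrite lee_fin density_ge0.
- by have [_] := nQ; apply.
have nFy := nnmfun_pair2 y nF.
rewrite marginYE integral_QX// -ge0_integralZr//; last 3 first.
- apply: emeasurable_funM; first by case: nFy.
  exact/measurable_EFinP/measurable_condX1.
- by move=> x _; rewrite mule_ge0 ?lee_fin ?condX_ge0//; case: nFy.
- by rewrite lee_fin ltW// density_marginY_gt0.
apply: eq_integral => x _; rewrite -muleA -EFinM /condX divfK//.
by rewrite gt_eqF// density_marginY_gt0.
Qed.

Lemma measurable_marginal_density x :
  measurable_fun setT (marginal_density pi ^~ x).
Proof.
apply: (@measurable_fun_fubini_tonelli_F _ _ _ _ _ muY
  (fun w : X * Y => (condX pi w.1 w.2 * condY pi w.2 x)%:E)).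
  apply/measurable_EFinP; apply: measurable_funM; first exact: measurable_condX.
  exact: (measurableT_comp (measurable_condY1 x)).
by move=> w; rewrite lee_fin mulr_ge0 ?condX_ge0 ?condY_ge0.
Qed.

(** If the law gives [A] mass 0, its density vanishes at almost every [x'] in [A]. For almost every
    [x'] the joint density is positive at almost every [y], so this vanishing forces
    [condY pi y x = 0] for almost every [y], against its integral 1. *)
Lemma P_X_null (supp : {ae muX \x muY, forall z, (0 < pi z)%R}) x A :
  measurable A -> P_X pi x A = 0 -> muX A = 0.
Proof.
move=> mA PA0; pose N := [set z | (pi z <= 0)%R].
have NE : N = [set z | ~ (0 < pi z)%R].
  by apply/seteqP; split => z; rewrite /N/= leNgt => /negP.
have mN : measurable N.
  rewrite -[N]setTI; apply: measurable_fun_le => //; exact: measurable_density.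
have N0 : (muX \x muY) N = 0 by apply: measure_negligible => //; rewrite NE.
have mk := measurable_marginal_density x.
have k0 x' : 0 <= marginal_density pi x' x.
  by apply: integral_ge0 => y _; rewrite lee_fin mulr_ge0 ?condX_ge0 ?condY_ge0.
have aeN : {ae muX, forall x', muY (xsection N x') = 0}.
  have : \int[muX]_x' `|(muY \o xsection N) x'| = 0.
    by rewrite -[RHS]N0; apply: eq_integral => x' _; rewrite gee0_abs.
  move=> /(ae_eq_integral_abs _ measurableT (measurable_fun_xsection muY mN)).
  by apply: filterS => x' /(_ Logic.I).
have aek : {ae muX, forall x', A x' -> marginal_density pi x' x = 0}.
  have : \int[muX]_(x' in A) `|marginal_density pi x' x| = 0.
    by rewrite -[RHS]PA0; apply: eq_integral => x' _; rewrite gee0_abs.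
  by move=> /(ae_eq_integral_abs _ mA (measurable_funTS mk)).
have aeA : {ae muX, forall x', ~ A x'}.
  move: aeN aek; apply: filterS2 => x' Nx' kx' Ax'.
  have ae0 : {ae muY, forall y, condX pi x' y * condY pi y x = 0}%R.
    have mc : measurable_fun setT (fun y => (condX pi x' y * condY pi y x)%:E).
      apply/measurable_EFinP; apply: measurable_funM; last exact: measurable_condY1.
      exact: (measurableT_comp (measurable_condX pi) (pair1_measurable x')).
    have : \int[muY]_y `|(condX pi x' y * condY pi y x)%:E| = 0.
      rewrite -[RHS](kx' Ax'); apply: eq_integral => y _.
      by rewrite gee0_abs// lee_fin mulr_ge0 ?condX_ge0 ?condY_ge0.
    move=> /(ae_eq_integral_abs _ measurableT mc).
    by apply: filterS => y /(_ Logic.I) [].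
  have aepi : {ae muY, forall y, 0 < pi (x', y)}%R.
    exists (xsection N x'); split => //; first exact: measurable_xsection.
    by move=> y /= piy; rewrite /xsection /= inE NE.
  have : \int[muY]_y (condY pi y x)%:E = \int[muY]_y (cst 0 y).
    apply: ae_eq_integral => //.
    - exact/measurable_EFinP/measurable_condY1.
    - move: ae0 aepi; apply: filterS2 => y /eqP + pi0 _.
      rewrite mulf_eq0 => /orP[|/eqP -> //].
      by rewrite /condX gt_eqF// divr_gt0// density_marginY_gt0.
  rewrite integral_condY integral0 => -[] /eqP; by rewrite oner_eq0.
have : muX.-negligible A.
  by apply: negligibleS aeA => x' Ax' /=; rewrite /setC /= => /(_ Ax').
exact: measure_negligible.
Qed.

(** Every law has exactly the null sets of [muX]: one inclusion is [P_X_null], the other holds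
    because the laws have densities. *)
Lemma P_X_mutually_abs_continuous
    (supp : {ae muX \x muY, forall z, (0 < pi z)%R}) x x' A :
  measurable A -> P_X pi x A = 0 -> P_X pi x' A = 0.
Proof.
move=> mA /(P_X_null supp mA) muA; rewrite /P_X /= /marginal_chain.
apply: null_set_integral => //; apply: measurable_funTS.
exact: measurable_marginal_density.
Qed.

End gibbs_operators.

(** * Geometric ergodicity *)

Section state_space_separation.
Context {R : realType} {U : pseudoMetricType R} {A : set U} {A0 : A !=set0}.
Local Notation Z := (state_space A0).

Lemma state_space_hausdorff : hausdorff_space U -> hausdorff_space Z.
Proof.
move=> hU p q clpq; apply: val_inj; apply: hU => B C Bp Cq.
have cv : continuous (@set_val U A : Z -> U) by exact: initial_continuous.
have [z [Bz Cz]] := clpq _ _ (cv p B Bp) (cv q C Cq).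
by exists (set_val z).
Qed.

(** Compact sublevel sets are closed in a Hausdorff space, hence Borel. Compactness is given at
    positive levels, so a level [r >= 0] is reached as the intersection of the levels
    [r + 1 / n.+1]; at negative levels the set is empty. *)
Lemma unbounded_off_compact_measurable (V : Z -> R) : hausdorff_space U ->
  (forall z, 0 <= V z)%R -> unbounded_off_compact V -> measurable_fun setT V.
Proof.
move=> hU V0 cV.
have clV (r : R) : (0 < r)%R -> measurable [set z | (V z <= r)%R].
  move=> r0; apply: state_space_closed_measurable.
  exact: compact_closed (state_space_hausdorff hU) (cV r r0).
have mV (r : R) : measurable [set z | (V z <= r)%R].
  have [r0|r0] := leP 0%R r; last first.
    rewrite (_ : [set _ | _] = set0)//; apply/seteqP; split => // z /= Vr.
    by have := le_lt_trans (le_trans (V0 z) Vr) r0; rewrite ltxx.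
  rewrite (_ : [set _ | _] = \bigcap_n [set z | (V z <= r + n.+1%:R^-1)%R]).
    by apply: bigcapT_measurable => n; apply: clV; rewrite ltr_wpDl.
  apply/seteqP; split => [z /= Vr n _ /=|z /= H].
    by rewrite (le_trans Vr)// lerDl.
  apply/ler_addgt0Pr => e e0.
  apply: le_trans (H (Num.truncn e^-1) Logic.I) _; rewrite lerD2l.
  rewrite -[leRHS]invrK lef_pV2 ?posrE ?invr_gt0//.
  by rewrite ltW// Num.Theory.truncnS_gt.
apply: (measurability _ (RGenOInfty.measurableE R)) => _ [_ [r ->] <-].
rewrite setTI (_ : _ @^-1` _ = ~` [set z | (V z <= r)%R]).
  exact: measurableC.
by apply/seteqP; split => z /=; rewrite in_itv/= andbT ltNge => /negP.
Qed.

End state_space_separation.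

(** In the drift of [V + e G] the coefficient of [V] contracts when [e < p / ((1 - p) lam)] and that
    of [G] when [e > p / (1 - p)]. The equation for [e] selects the midpoint of this interval. *)
Lemma random_scan_rate {R : realFieldType} (p lam e : R) :
  (0 < p < 1)%R -> (0 < lam < 1)%R ->
  (e * (2 * (1 - p) * lam) = p * (1 + lam))%R ->
  [/\ (0 < e)%R, (0 < 1 - p * (1 - p) * (1 - lam) / 2 < 1)%R,
      ((1 - p) * (1 + e * lam) <= 1 - p * (1 - p) * (1 - lam) / 2)%R &
      (p * (1 + e) <= (1 - p * (1 - p) * (1 - lam) / 2) * e)%R].
Proof.
move=> /andP[p0 p1] /andP[l0 l1] eE.
have q0 : (0 < 1 - p)%R by rewrite subr_gt0.
have u0 : (0 < 1 - lam)%R by rewrite subr_gt0.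
have k0 : (0 < 2 * (1 - p) * lam)%R by rewrite !mulr_gt0.
have e0 : (0 < e)%R by rewrite -(pmulr_lgt0 _ k0) eE mulr_gt0// addr_gt0.
have pq0 := mulr_gt0 p0 q0; have pqu0 := mulr_gt0 pq0 u0.
have pu0 := mulr_gt0 p0 u0; have qu0 := mulr_gt0 q0 u0; have ppu0 := mulr_gt0 p0 pu0.
split => //.
- by apply/andP; split; lra.
- by move: eE; lra.
- rewrite -(ler_pM2r k0).
  have -> : (p * (1 + e) * (2 * (1 - p) * lam) =
      p * (2 * (1 - p) * lam) + p * (p * (1 + lam)))%R by rewrite -eE; lra.
  rewrite -[leRHS]mulrA eE -subr_ge0.
  have -> : ((1 - p * (1 - p) * (1 - lam) / 2) * (p * (1 + lam)) -
      (p * (2 * (1 - p) * lam) + p * (p * (1 + lam))) =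
      p * (1 - p) * (1 - lam) * (1 - p * (1 + lam) / 2))%R by lra.
  rewrite mulr_ge0 ?(ltW pqu0)// subr_ge0.
  by have := mulr_ile1 (ltW p0) (ltW l0) (ltW p1) (ltW l1); lra.
Qed.

Section gibbs_ergodicity.
Context {R : realType} {U1 U2 : pseudoMetricType R} {A1 : set U1} {A2 : set U2}
  {X0 : A1 !=set0} {Y0 : A2 !=set0}.
Local Notation X := (state_space X0).
Local Notation Y := (state_space Y0).
Variables (muX : {sigma_finite_measure set X -> \bar R})
  (muY : {sigma_finite_measure set Y -> \bar R})
  (varpi : probability (X * Y)%type R) (pi : joint_density muX muY varpi)
  (p : R) (p01 : (0 < p < 1)%R) (V : X -> R) (c lam L : R).
Hypotheses (hU1 : hausdorff_space U1) (lcX : locally_compact [set: X]).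
Hypothesis supp : {ae muX \x muY, forall z, (0 < pi z)%R}.
Hypothesis fellerX : feller (fun x A => P_X pi x A).
Hypothesis fellerRGS : feller (fun z A => P_RGS pi p01 z A).
Hypotheses (V0 : forall x, (0 <= V x)%R) (c0 : (0 < c)%R).
Hypothesis G_lty : forall y, drift_G pi V y < +oo.
Hypothesis cptV : unbounded_off_compact V.
Hypothesis cptW : unbounded_off_compact (drift_W pi V c).
Hypothesis lam01 : (0 < lam < 1)%R.
Hypothesis drift : forall x,
  kernel_op (P_X pi) (EFin \o V) x <= (lam * V x + L)%:E.

Let TX := kernel_op (P_X pi).
Let TD := kernel_op (P_DGS pi).
Let TR := kernel_op (P_RGS pi p01).
Let mTX : markov_op TX := kernel_op_markov (P_X pi).
Let mTD : markov_op TD := kernel_op_markov (P_DGS pi).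
Let mTR : markov_op TR := kernel_op_markov (P_RGS pi p01).
Let mV : measurable_fun setT V := unbounded_off_compact_measurable hU1 V0 cptV.
Let nV : nnmfun (EFin \o V) := nnmfun_EFin mV V0.
Let mQX y : mean (fun F => \int[QX pi y]_x F x).
Proof. exact/mean_integral/integral_condX. Qed.
Let mQY x : mean (fun F => \int[QY pi x]_y F y).
Proof. exact/mean_integral/integral_condY. Qed.
Let mw : mean (fun F => \int[varpi]_z F z).
Proof. exact/mean_integral/probability_setT. Qed.

Let drift_abs x : TX (EFin \o V) x <= (lam * V x + `|L|)%:E.
Proof. by apply: le_trans (drift x) _; rewrite lee_fin lerD2l ler_norm. Qed.

(** From [(point, y)] the random scan charges the cylinder over [O] with [p] times [QX pi y O] plus
    a constant, the first coordinate being fixed. Lower semicontinuity in [y] is thus inherited. *)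
Lemma feller_QX (O : set X) : open O ->
  lower_semicontinuous (fun y => QX pi y O).
Proof.
move=> oO; apply/lower_semicontinuousP => r.
have mO := state_space_open_measurable oO.
have oS : open (@fst X Y @^-1` O).
  by apply: open_comp => // z _; exact: cvg_fst.
have mS : measurable (@fst X Y @^-1` O).
  by rewrite -[_ @^-1` _]setTI; exact: measurable_fst.
have [p0 p1] := andP p01.
pose k := ((1 - p) * \1_O (point : X))%R.
rewrite (_ : [set y | _] =
    pair point @^-1` [set z | P_RGS pi p01 z (@fst X Y @^-1` O) > (p * r + k)%:E]).
  apply: open_comp.
    move=> y _ B [[B1 B2] [/= B1x B2y] B12]; apply: filterS B2y => y' B2y'.
    by apply: B12; split => //=; exact: nbhs_singleton.
  exact: ((lower_semicontinuousP _).1 (fellerRGS oS)).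
apply/funext => y; apply/propext => /=.
have -> : P_RGS pi p01 (point, y) (@fst X Y @^-1` O) =
    kernel_op (P_RGS pi p01) (EFin \o \1_(@fst X Y @^-1` O)) (point, y).
  by rewrite /kernel_op integral_indic// setIT.
rewrite kernel_op_P_RGS; last exact: nnmfun_indic.
have -> : \int[QX pi y]_x (\1_(@fst X Y @^-1` O) (x, y))%:E = QX pi y O.
  by rewrite -[in RHS](setIT O) -integral_indic.
rewrite (_ : \int[QY pi point]_y' _ = (\1_O (point : X))%:E); last first.
  rewrite -[RHS](mean_cst (mQY point))//.
pose q := fine (QX pi y O).
have QE : QX pi y O = q%:E.
  by rewrite /q fineK// unit_mass_fin_num//; exact: integral_condX.
rewrite -[cond_lawX pi y O]/(QX pi y O) QE -EFinM -/k -EFinM -EFinD !lte_fin.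
by rewrite ltrD2r ltr_pM2l.
Qed.

Lemma fine_drift_G y : (fine (drift_G pi V y))%:E = \int[QX pi y]_x (V x)%:E.
Proof.
have -> : \int[QX pi y]_x (V x)%:E = drift_G pi V y.
  by rewrite integral_QX//; apply: eq_integral => x _; rewrite EFinM.
rewrite fineK// ge0_fin_numE ?G_lty//; apply: integral_ge0 => x _.
by rewrite lee_fin mulr_ge0// condX_ge0.
Qed.

Definition fst_mfun : {mfun (X * Y)%type >-> X} :=
  HB.pack (@fst X Y) (isMeasurableFun.Build _ _ _ _ _ (@measurable_fst _ _ X Y)).

Lemma integral_distribution_fst (F : X -> \bar R) : nnmfun F ->
  \int[distribution varpi fst_mfun]_x F x = \int[varpi]_z F z.1.
Proof. by move=> [mF F0]; rewrite ge0_integral_distribution. Qed.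

Lemma mean_fst : mean (fun F : X -> \bar R => \int[varpi]_z F z.1).
Proof.
split.
- exact: (mean1 mw).
- by move=> F G nF nG FG; apply: (le_mean mw); [exact: nnmfun_fst|exact: nnmfun_fst|].
- by move=> F G nF nG; rewrite -(meanD mw)//; exact: nnmfun_fst.
- by move=> k F k0 nF; rewrite -(meanZ mw)//; exact: nnmfun_fst.
Qed.

Lemma stationary_fst (F : X -> \bar R) : nnmfun F ->
  \int[varpi]_z TX F z.1 = \int[varpi]_z F z.1.
Proof.
move=> nF.
have nQ := nnmfun_integral_QX pi (nnmfun_fst nF).
transitivity (\int[varpi]_z \int[QY pi z.1]_y \int[QX pi y]_x F x).
  by apply: eq_integral => z _; rewrite /TX kernel_op_P_X.
rewrite (stationary_QY pi (nnmfun_snd nQ)).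
exact: (stationary_QX pi (nnmfun_fst nF)).
Qed.

Let small : exists (O : set X) (al : R), [/\ open O, (0 < al)%R,
  forall x, 0 < P_X pi x O & forall F G : X -> \bar R, nnmfun F -> nnmfun G ->
  (forall x, F x + G x = 1) ->
  (forall x, al%:E * P_X pi x O <= TX (TX F) x) \/
  (forall x, al%:E * P_X pi x O <= TX (TX G) x)].
Proof.
(* The shift to [n.+1] keeps the level positive, where compactness is given. *)
pose K n := [set x | (V x <= n.+1%:R)%R].
have cK n : compact (K n) by exact: cptV.
have KT : \bigcup_n K n = setT.
  apply/seteqP; split => // x _; exists (Num.truncn (V x)) => //.
  by rewrite /K/= ltW// Num.Theory.truncnS_gt.
have eq0 x x' (B : set X) : measurable B -> P_X pi x B = 0 -> P_X pi x' B = 0.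
  exact: P_X_mutually_abs_continuous.
exact: (feller_small_open lcX fellerX cK KT eq0).
Qed.

(** Harris' theorem with blocks of two steps: [small] bounds the two-step laws from below by a
    multiple of [P_X pi x O], which is bounded below on sublevel sets of [V]. *)
Lemma marginal_chain_convergence : exists (C t : R), [/\ (0 <= C)%R,
  (0 < t < 1)%R & forall F : X -> \bar R, nnmfun F -> (forall x, F x <= 1) ->
  forall n x,
    iter n TX F x <= \int[varpi]_z F z.1 + (C * (1 + V x) * t ^+ n)%:E /\
    \int[varpi]_z F z.1 <= iter n TX F x + (C * (1 + V x) * t ^+ n)%:E].
Proof.
have [ O [al [oO al0 PO0 smallO]]] := small.
apply: (@geometric_convergence _ _ _ TX V lam `|L| 2
  (fun F => \int[varpi]_z F z.1)) => //.
- move=> r.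
  have r0 : (0 < `|r| + 1)%R by rewrite ltr_wpDl.
  have [dl dl0 dlP] := lower_semicontinuous_compact_ge (cptV r0)
    (fellerX oO) (fun x _ => PO0 x).
  exists (al * dl)%R; first exact: mulr_gt0.
  move=> x y xr yr F G nF nG FG.
  have le_r s : (s <= r)%R -> (s <= `|r| + 1)%R.
    by move=> sr; rewrite (le_trans sr)// (le_trans (ler_norm r))// lerDl.
  have T0 H u : nnmfun H -> 0 <= iter 2 TX H u.
    by move=> nH; have [] := markov_nnmfun (markov_op_iter 2 mTX) nH.
  have bd u : (V u <= r)%R -> (al * dl)%:E <= al%:E * P_X pi u O.
    by move=> ur; rewrite EFinM lee_wpmul2l ?lee_fin ?(ltW al0)// dlP//=; exact: le_r.
  have [HF|HG] := smallO F G nF nG FG.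
  + by rewrite -[leLHS]adde0 leeD ?T0// (le_trans (bd x xr))//; exact: HF.
  + by rewrite -[leLHS]add0e leeD ?T0// (le_trans (bd y yr))//; exact: HG.
- exact: mean_fst.
- exact: stationary_fst.
- rewrite -integral_distribution_fst//.
  apply: (@stationary_drift_lty _ _ _ (P_X pi) _ V lam `|L|) => //.
  + exact: probability_setT.
  + move=> F nF; rewrite !integral_distribution_fst//; first exact: stationary_fst.
    exact: markov_nnmfun.
  + by have [/ltW -> ->] := andP lam01.
Qed.

Theorem P_X_geometrically_ergodic :
  geometrically_ergodic (P_X pi) (pushforward varpi fst).
Proof.
have [C [t [C0 t01 H]]] := marginal_chain_convergence.
apply: (@geometrically_ergodicP _ _ _ _ (distribution varpi fst_mfun)
  (fun x => C * (1 + V x))%R t) => //.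
  exact: probability_setT.
move=> B n x mB; rewrite kernel_iterE.
have nB := nnmfun_indic (R := R) mB.
have [x'|h1 h2] := H _ nB _ n x.
  by rewrite /= lee_fin indicE; case: (x' \in B).
have wB : \int[varpi]_z (EFin \o \1_B) z.1 = distribution varpi fst_mfun B.
  by rewrite -integral_distribution_fst// integral_indic// setIT.
by move: h1 h2; rewrite wB; split.
Qed.

(** The draws alternate, x given y and then y given x. Setting the first and the last draw apart
    leaves [n] pairs in the opposite order, each a step of the marginal chain; hence the shift from
    [n.+1] to [n]. *)
Lemma iter_P_DGS (F : X * Y -> \bar R) n z : nnmfun F ->
  iter n.+1 TD F z =
  \int[QX pi z.2]_x iter n TX (fun x => \int[QY pi x]_y F (x, y)) x.
Proof.
move=> nF; elim: n z => [|n ih] z; first exact: kernel_op_P_DGS.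
rewrite iterS /TD kernel_op_P_DGS; last first.
  exact: (markov_nnmfun (markov_op_iter n.+1 mTD)).
apply: eq_integral => x _; rewrite [in RHS]iterS [RHS]kernel_op_P_X; last first.
  exact/(markov_nnmfun (markov_op_iter n mTX))/nnmfun_integral_QY.
by apply: eq_integral => y _; exact: ih.
Qed.

Theorem P_DGS_geometrically_ergodic : geometrically_ergodic (P_DGS pi) varpi.
Proof.
have [C [t [C0 t01 H]]] := marginal_chain_convergence.
have [t0 t1] := andP t01; have t_ge0 := ltW t0.
pose g y := fine (drift_G pi V y).
have g0 y : (0 <= g y)%R.
  by rewrite -lee_fin fine_drift_G; apply: integral_ge0 => x _; rewrite lee_fin.
have Cg0 y : (0 <= C * (1 + g y))%R by rewrite mulr_ge0// addr_ge0.
(* The division by [t] makes up for the one step lost to the marginal chain; the added 1 covers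
   [n = 0]. *)
apply: (@geometrically_ergodicP _ _ _ _ varpi
  (fun z => C * (1 + g z.2) / t + 1)%R t) => //.
  exact: probability_setT.
move=> B n z mB; rewrite kernel_iterE.
have nB := nnmfun_indic (R := R) mB.
have B1 w : (EFin \o \1_B) w <= 1 :> \bar R.
  by rewrite /= lee_fin indicE; case: (w \in B).
have varpiB : varpi B = \int[varpi]_w (EFin \o \1_B) w.
  by rewrite integral_indic// setIT.
have varpiB1 : varpi B <= 1 by rewrite probability_le1.
case: n => [|n].
  have M1 : (1 <= (C * (1 + g z.2) / t + 1) * t ^+ 0)%R.
    by rewrite expr0 mulr1 lerDr divr_ge0// ltW.
  split.
    rewrite (le_trans (B1 z))// -[leLHS]add0e leeD// ?lee_fin//.
  by rewrite (le_trans varpiB1)// -[leLHS]add0e leeD ?lee_fin//; case: nB.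
have h0 := nnmfun_integral_QY pi nB.
have h1 x : \int[QY pi x]_y (EFin \o \1_B) (x, y) <= 1.
  by apply: (mean_le1 (mQY x)) => //; exact: nnmfun_pair1.
have wh : \int[varpi]_w \int[QY pi w.1]_y (EFin \o \1_B) (w.1, y) = varpi B.
  by rewrite (stationary_QY pi nB) varpiB.
rewrite (iter_P_DGS n z nB).
have Mt : (C * (1 + g z.2) * t ^+ n <= (C * (1 + g z.2) / t + 1) * t ^+ n.+1)%R.
  rewrite mulrDl exprS [(_ / t * _)%R]mulrA divfK ?gt_eqF// lerDl mul1r.
  by rewrite mulr_ge0// exprn_ge0.
set b := (C * (1 + g z.2) * t ^+ n)%R in Mt.
have Ctn0 : (0 <= C * t ^+ n)%R by rewrite mulr_ge0// exprn_ge0.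
pose f x := (C * t ^+ n + C * t ^+ n * V x)%R.
have nf : nnmfun (EFin \o f).
  apply: nnmfun_EFin => [|x].
    by apply: measurable_funD => //; exact: measurable_funM.
  by rewrite addr_ge0// mulr_ge0.
have Ef : \int[QX pi z.2]_x (EFin \o f) x = b%:E.
  rewrite (mean_affine (mQX z.2) Ctn0 Ctn0 mV V0) -fine_drift_G -EFinM -EFinD.
  by congr EFin; rewrite /b /g; lra.
have fE x : (C * (1 + V x) * t ^+ n = f x)%R by rewrite /f; lra.
have nT := markov_nnmfun (markov_op_iter n mTX) h0.
have vfin : varpi B = (fine (varpi B))%:E by rewrite fineK// fin_num_measure.
have v0 : (0 <= fine (varpi B))%R by rewrite fine_ge0.
have key1 : \int[QX pi z.2]_x iter n TX (fun x => \int[QY pi x]_y (EFin \o \1_B) (x, y)) x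
    <= varpi B + b%:E.
  rewrite -Ef vfin -(mean_cst (mQX z.2) v0) -(meanD (mQX z.2))//.
  apply: (le_mean (mQX z.2)) => //; first exact: nnmfunD.
  move=> x; have [+ _] := H _ h0 h1 n x.
  by rewrite wh fE {1}vfin.
have key2 : varpi B <= \int[QX pi z.2]_x
    iter n TX (fun x => \int[QY pi x]_y (EFin \o \1_B) (x, y)) x + b%:E.
  rewrite -Ef vfin -(mean_cst (mQX z.2) v0) -(meanD (mQX z.2))//.
  apply: (le_mean (mQX z.2)) => //; first exact: nnmfunD.
  move=> x; have [_] := H _ h0 h1 n x.
  by rewrite wh fE {1}vfin.
split.
- by apply: le_trans key1 _; rewrite leeD2l// lee_fin.
- by apply: le_trans key2 _; rewrite leeD2l// lee_fin.
Qed.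

(** With probability [p * (1 - p)] two random scan steps update x and then y, as one deterministic
    scan does. The factor [b] lets the comparison be iterated. *)
Lemma P_RGS_ge_P_DGS (F G : X * Y -> \bar R) (b : R) z : nnmfun F -> nnmfun G ->
  (0 <= b)%R -> (forall w, b%:E * F w <= G w) ->
  (p * (1 - p) * b)%:E * TD F z <= TR (TR G) z.
Proof.
move=> nF nG b0 FG; have [p0 p1] := andP p01.
have p_ge0 := ltW p0; have q_ge0 : (0 <= 1 - p)%R by rewrite subr_ge0 ltW.
have nTG := markov_nnmfun mTR nG.
have nQF := nnmfun_integral_QY pi nF.
rewrite {1}/TR kernel_op_P_RGS// /TD kernel_op_P_DGS//.
apply: (@le_trans _ _ (p%:E * \int[QX pi z.2]_x TR G (x, z.2))); last first.
  rewrite leeDl// mule_ge0 ?lee_fin//.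
  exact/(mean_ge0 (mQY z.1))/nnmfun_pair1.
rewrite -mulrA EFinM -muleA lee_wpmul2l ?lee_fin//.
rewrite -(meanZ (mQX z.2)) ?mulr_ge0//; apply: (le_mean (mQX z.2)).
- by apply: nnmfunZ => //; rewrite mulr_ge0.
- exact: nnmfun_pair2.
move=> x; rewrite /TR kernel_op_P_RGS//=.
apply: (@le_trans _ _ ((1 - p)%:E * \int[QY pi x]_y G (x, y))); last first.
  rewrite leeDr// mule_ge0 ?lee_fin//.
  exact/(mean_ge0 (mQX z.2))/nnmfun_pair2.
rewrite EFinM -muleA lee_wpmul2l ?lee_fin// -(meanZ (mQY x))//;
   last exact: nnmfun_pair1.
apply: (le_mean (mQY x)) => //; last exact: nnmfun_pair1.
by apply: nnmfunZ => //; exact: nnmfun_pair1.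
Qed.

Let g y := fine (drift_G pi V y).

Let g0 y : (0 <= g y)%R.
Proof.
by rewrite -lee_fin fine_drift_G; apply: integral_ge0 => x _; rewrite lee_fin.
Qed.

Let mg : measurable_fun setT g.
Proof.
apply/measurable_EFinP; have := nnmfun_integral_QX pi (nnmfun_fst nV).
by case=> + _; apply: eq_measurable_fun => y _ /=; rewrite fine_drift_G.
Qed.

Let e := (p * (1 + lam) / (2 * (1 - p) * lam))%R.
Let rho := (1 - p * (1 - p) * (1 - lam) / 2)%R.
Let W z := (V z.1 + e * g z.2)%R.

Let rate : [/\ (0 < e)%R, (0 < rho < 1)%R, ((1 - p) * (1 + e * lam) <= rho)%R &
  (p * (1 + e) <= rho * e)%R].
Proof.
apply: random_scan_rate => //; rewrite /e divfK// gt_eqF//.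
by have [p0 p1] := andP p01; have [l0 _] := andP lam01; rewrite !mulr_gt0// subr_gt0.
Qed.

Let W0 z : (0 <= W z)%R.
Proof. by have [e0 _ _ _] := rate; rewrite addr_ge0// mulr_ge0// ltW. Qed.

Let mW : measurable_fun setT W.
Proof.
apply: measurable_funD; first exact: measurableT_comp.
by apply: measurable_funM => //; exact: measurableT_comp.
Qed.

(** Updating x given y replaces [V] by [G] and keeps [G]; updating y given x keeps [V] and turns [G]
    into [P_X V], to which the drift condition applies. [rate] absorbs both coefficients. *)
Let W_drift z : TR (EFin \o W) z <= (rho * W z + (1 - p) * e * `|L|)%:E.
Proof.
have [e0 rho01 r1 r2] := rate; have [p0 p1] := andP p01.
have e_ge0 := ltW e0; have q0 : (0 <= 1 - p)%R by rewrite subr_ge0 ltW.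
rewrite /TR kernel_op_P_RGS; last exact: nnmfun_EFin.
have -> : \int[QX pi z.2]_x (EFin \o W) (x, z.2) = (e * g z.2 + g z.2)%:E.
  rewrite [LHS](_ : _ = \int[QX pi z.2]_x (e * g z.2 + 1 * V x)%:E); last first.
    by apply: eq_integral => x _; rewrite /= /W /= mul1r addrC.
  rewrite (mean_affine (mQX z.2) (mulr_ge0 e_ge0 (g0 z.2)) ler01 mV V0).
  by rewrite -fine_drift_G mul1e.
have ng : nnmfun (EFin \o g) by exact: nnmfun_EFin.
have gE : \int[QY pi z.1]_y (EFin \o g) y <= (lam * V z.1 + `|L|)%:E.
  apply: le_trans (drift_abs z.1); rewrite /TX kernel_op_P_X//.
  rewrite le_eqVlt; apply/orP; left; apply/eqP/eq_integral => y _.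
  by rewrite /= fine_drift_G.
apply: (@le_trans _ _ (p%:E * (e * g z.2 + g z.2)%:E +
    (1 - p)%:E * ((V z.1)%:E + e%:E * (lam * V z.1 + `|L|)%:E))).
  rewrite leeD2l// lee_wpmul2l ?lee_fin//.
  rewrite [leLHS](_ : _ = \int[QY pi z.1]_y (V z.1 + e * g y)%:E)//.
  by rewrite (mean_affine (mQY z.1))// leeD2l// lee_wpmul2l.
rewrite -!EFinM -!EFinD lee_fin.
have := ler_wpM2r (V0 z.1) r1; have := ler_wpM2r (g0 z.2) r2.
by rewrite /W; lra.
Qed.

(** [V + c G] is at most [(1 + c / e) (V + e G)]. The level [|r| + 1] is used because it is
    positive. *)
Let W_sublevel (r : R) : exists2 K : set (X * Y), compact K &
  forall z, (W z <= r)%R -> K z.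
Proof.
have [e0 _ _ _] := rate.
exists [set z | (drift_W pi V c z <= (1 + c / e) * (`|r| + 1))%R].
  by apply: cptW; rewrite mulr_gt0// addr_gt0// divr_gt0.
move=> z Wr /=; apply: (@le_trans _ _ ((1 + c / e) * W z)%R).
  rewrite /drift_W -/(g z.2) /W mulrDl mul1r.
  have -> : (c / e * (V z.1 + e * g z.2) = c / e * V z.1 + c * g z.2)%R.
    by rewrite mulrDr [(c / e * (e * _))%R]mulrA divfK// gt_eqF.
  have h1 : (0 <= c / e * V z.1)%R by rewrite mulr_ge0// divr_ge0 ?ltW.
  have h2 : (0 <= e * g z.2)%R by rewrite mulr_ge0 ?(ltW e0).
  by lra.
rewrite ler_wpM2l//.
  by rewrite addr_ge0// divr_ge0 ?ltW.
by rewrite (le_trans Wr)// (le_trans (ler_norm r))// lerDl.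
Qed.

(** Three deterministic scans are a draw of x, two marginal steps and a draw of y, so [small]
    applies to the averages of [F] and [G] over y. Six random scan steps dominate them up to the
    factor [k ^+ 3]. *)
Let RGS_overlap (r : R) : exists2 al : R, (0 < al)%R & forall z z',
  (W z <= r)%R -> (W z' <= r)%R -> overlap al (iter 6 TR ^~ z) (iter 6 TR ^~ z').
Proof.
have [ O [al [oO al0 PO0 smallO]]] := small.
have [K cK WK] := W_sublevel r.
have mO := state_space_open_measurable oO.
have nPO : nnmfun (fun x => P_X pi x O).
  by split => // x; exact: measurable_kernel.
(* The first draw depends on the second coordinate alone, so uniformity is needed on this
   projection. *)
have cK2 : compact (snd @` K).
  apply: continuous_compact => //; apply: continuous_subspaceT => z.
  exact: cvg_snd.
have [dl dl0 dlP] := feller_compact_ge (Q := QX pi) (integral_condX pi) feller_QX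
  nPO (fellerX oO) PO0 cK2.
have [p0 p1] := andP p01; have q0 : (0 < 1 - p)%R by rewrite subr_gt0.
pose k := (p * (1 - p))%R; have k0 : (0 < k)%R by rewrite mulr_gt0.
have k_ge0 := ltW k0.
have lower (F : X * Y -> \bar R) z : nnmfun F -> K z ->
    (forall x, al%:E * P_X pi x O <=
      TX (TX (fun x => \int[QY pi x]_y F (x, y))) x) ->
    (k ^+ 3 * (al * dl))%:E <= iter 6 TR F z.
  move=> nF Kz H.
  (* The nested product matches three successive uses of [P_RGS_ge_P_DGS], starting from [b = 1]. *)
  apply: (@le_trans _ _ ((k * (k * (k * 1)))%:E * iter 3 TD F z)).
    have -> : (k * (k * (k * 1)) = k ^+ 3)%R by rewrite mulr1 -expr2 -exprS.
    rewrite [leLHS]EFinM lee_wpmul2l// ?lee_fin ?exprn_ge0//.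
    rewrite (iter_P_DGS 2 z nF) EFinM.
    apply: (@le_trans _ _ (al%:E * \int[QX pi z.2]_x P_X pi x O)).
      by rewrite lee_wpmul2l ?lee_fin ?(ltW al0)// dlP//=; exists z.
    rewrite -(meanZ (mQX z.2) (ltW al0) nPO); apply: (le_mean (mQX z.2)) => //.
    - by apply: nnmfunZ => //; exact: ltW.
    - exact/(markov_nnmfun (markov_op_iter 2 mTX))/nnmfun_integral_QY.
  have nD j := markov_nnmfun (markov_op_iter j mTD) nF.
  have nR j := markov_nnmfun (markov_op_iter j mTR) nF.
  have s1 w : (k * 1)%:E * TD F w <= iter 2 TR F w.
    by apply: P_RGS_ge_P_DGS => // w'; rewrite mul1e.
  have s2 w : (k * (k * 1))%:E * iter 2 TD F w <= iter 4 TR F w.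
    apply: P_RGS_ge_P_DGS s1; [exact: (nD 1%N)|exact: (nR 2%N)|by rewrite mulr1].
  apply: P_RGS_ge_P_DGS s2; [exact: (nD 2%N)|exact: (nR 4%N)|].
  by rewrite mulr1 -expr2 exprn_ge0.
exists (k ^+ 3 * (al * dl))%R; first by rewrite mulr_gt0 ?exprn_gt0// mulr_gt0.
move=> z z' /WK Kz /WK Kz' F G nF nG FG.
have T0 H u : nnmfun H -> 0 <= iter 6 TR H u.
  by move=> nH; have [] := markov_nnmfun (markov_op_iter 6 mTR) nH.
have hFG x : \int[QY pi x]_y F (x, y) + \int[QY pi x]_y G (x, y) = 1.
  rewrite -(meanD (mQY x)); [|exact: nnmfun_pair1|exact: nnmfun_pair1].
  by rewrite -[RHS](mean1 (mQY x)); apply: eq_integral => y _; exact: FG.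
have [HF|HG] := smallO _ _ (nnmfun_integral_QY pi nF) (nnmfun_integral_QY pi nG) hFG.
- by rewrite -[leLHS]adde0 leeD ?T0//; exact: lower.
- by rewrite -[leLHS]add0e leeD ?T0//; exact: lower.
Qed.

Theorem P_RGS_geometrically_ergodic : geometrically_ergodic (P_RGS pi p01) varpi.
Proof.
have [e0 rho01 _ _] := rate; have [p0 p1] := andP p01.
have e_ge0 := ltW e0; have q0 : (0 <= 1 - p)%R by rewrite subr_ge0 ltW.
have K0 : (0 <= (1 - p) * e * `|L|)%R by apply: mulr_ge0 => //; exact: mulr_ge0.
have stat F : nnmfun F -> \int[varpi]_z TR F z = \int[varpi]_z F z.
  move=> nF.
  have n1 := nnmfun_snd (X := X) (nnmfun_integral_QX pi nF).
  have n2 := nnmfun_fst (Y := Y) (nnmfun_integral_QY pi nF).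
  transitivity (\int[varpi]_z (p%:E * \int[QX pi z.2]_x F (x, z.2) +
      (1 - p)%:E * \int[QY pi z.1]_y F (z.1, y))).
    by apply: eq_integral => z _; rewrite /TR kernel_op_P_RGS.
  rewrite (meanD mw); [|exact: nnmfunZ (ltW p0) n1|exact: nnmfunZ q0 n2].
  rewrite (meanZ mw (ltW p0) n1) (meanZ mw q0 n2) stationary_QX// stationary_QY//.
  by rewrite -ge0_muleDl ?lee_fin ?(ltW p0)// -EFinD subrKC mul1e.
have rho01' : (0 <= rho < 1)%R by have [/ltW -> ->] := andP rho01.
have wW := stationary_drift_lty (probability_setT varpi) stat mW W0 rho01' K0 W_drift.
have [C [t [C0 t01 H]]] := @geometric_convergence _ _ _ TR W rho _ 6
  (fun F => \int[varpi]_z F z) mTR mW W0 rho01 K0 isT W_drift RGS_overlap mw stat wW.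
apply: (@geometrically_ergodicP _ _ _ _ varpi (fun z => C * (1 + W z))%R t) => //.
  exact: probability_setT.
move=> B n z mB; rewrite kernel_iterE.
have nB := nnmfun_indic (R := R) mB.
have [z'|h1 h2] := H _ nB _ n z.
  by rewrite /= lee_fin indicE; case: (z' \in B).
have wB : \int[varpi]_z (EFin \o \1_B) z = varpi B.
  by rewrite integral_indic// setIT.
by move: h1 h2; rewrite wB; split.
Qed.

End gibbs_ergodicity.

Theorem proposition1 (R : realType) (k l : nat) (hk : (1 <= k)%N) (hl : (1 <= l)%N)
  (X : set 'rV[R]_k) (Y : set 'rV[R]_l) (X0 : X !=set0) (Y0 : Y !=set0)
  (lcX : locally_compact [set: state_space X0])
  (lcY : locally_compact [set: state_space Y0])
  (muX : {sigma_finite_measure set (state_space X0) -> \bar R})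
  (muY : {sigma_finite_measure set (state_space Y0) -> \bar R})
  (varpi : probability (state_space X0 * state_space Y0)%type R)
  (pi : joint_density muX muY varpi)
  (supp : {ae muX \x muY, forall z, (0 < pi z)%R})
  (p : R) (p01 : (0 < p < 1)%R)
  (fellerX : feller (fun x A => P_X pi x A))
  (fellerRGS : feller (fun z A => P_RGS pi p01 z A)) :
  (exists (V : state_space X0 -> R) (c lambda L : R),
    [/\ (forall x, 0 <= V x)%R /\ (forall y, drift_G pi V y < +oo),
        (0 < c)%R,
        unbounded_off_compact V /\ unbounded_off_compact (drift_W pi V c),
        (0 < lambda < 1)%R &
        forall x, kernel_op (P_X pi) (EFin \o V) x <= (lambda * V x + L)%:E]) ->
  [/\ geometrically_ergodic (P_X pi) (pushforward varpi fst),
      geometrically_ergodic (P_DGS pi) varpi &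
      geometrically_ergodic (P_RGS pi p01) varpi].
Proof.
move=> [V [c [lam [L [[V0 G_lty] c0 [cptV cptW] lam01 drift]]]]].
have hU1 : hausdorff_space 'rV[R]_k by exact: norm_hausdorff.
split.
- exact: (P_X_geometrically_ergodic hU1 lcX supp fellerX V0 cptV lam01 drift).
- exact: (P_DGS_geometrically_ergodic hU1 lcX supp fellerX V0 G_lty cptV lam01 drift).
- exact: (P_RGS_geometrically_ergodic hU1 lcX supp fellerX fellerRGS V0 c0 G_lty
    cptV cptW lam01 drift).
Qed.
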